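(* Let $\gamma_D$ and $\gamma_E$ be independent nonnegative random variables, where for $i\in\{D,E\}$ the variable $\gamma_i$ is the instantaneous SNR of a fluctuating two-ray (FTR) fading channel with parameters $m_i>0$, $K_i\ge 0$, $\Delta_i\in[0,1]$, $\sigma_i^2>0$, i.e. $\gamma_i$ has the density $f_i$ given in the context, with coefficients $d_{j_i}$ as defined there. Then the average secrecy capacity $$ASC=\mathbb{E}\big[\max\{\ln(1+\gamma_D)-\ln(1+\gamma_E),\,0\}\big]$$ equals $$ \begin{aligned} ASC ={}& \frac{m_D^{m_D} m_E^{m_E}}{\Gamma(m_D)\Gamma(m_E)}\sum_{j_D=0}^\infty\sum_{j_E=0}^\infty \frac{K_D^{j_D} d_{j_D} K_E^{j_E} d_{j_E}}{j_D!\,j_E!}\Bigg( \frac{S\big(j_D+1,(2\sigma_D^2)^{-1}\big)}{j_D!\,(2\sigma_D^2)^{j_D+1}} + \frac{S\big(j_E+1,(2\sigma_E^2)^{-1}\big)}{j_E!\,(2\sigma_E^2)^{j_E+1}}\\ &\quad - \sum_{n=0}^{j_E}\frac{S\Big(j_D+n+1,\frac{\sigma_D^2+\sigma_E^2}{2\sigma_D^2\sigma_E^2}\Big)}{n!\,j_D!\,(2\sigma_E^2)^n(2\sigma_D^2)^{j_D+1}} - \sum_{n=0}^{j_D}\frac{S\Big(j_E+n+1,\frac{\sigma_D^2+\sigma_E^2}{2\sigma_D^2\sigma_E^2}\Big)}{n!\,j_E!\,(2\sigma_D^2)^n(2\sigma_E^2)^{j_E+1}}\Bigg)\\ & - \frac{m_E^{m_E}}{\Gamma(m_E)}\sum_{j_E=0}^\infty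 \frac{K_E^{j_E} d_{j_E}\,S\big(j_E+1,(2\sigma_E^2)^{-1}\big)}{j_E!\,j_E!\,(2\sigma_E^2)^{j_E+1}}, \end{aligned} $$ where, for a positive integer $w$ and $\mu>0$, $$S(w,\mu) := (w-1)!\,e^{\mu}\sum_{k=1}^{w}\frac{\Gamma(-w+k,\mu)}{\mu^k}.$$
   Context: For $i\in\{D,E\}$ ($D$: main channel to the legitimate receiver; $E$: eavesdropper channel), the FTR fading SNR $\gamma_i$ has probability density on $(0,\infty)$ $$f_i(\gamma)=\frac{m_i^{m_i}}{\Gamma(m_i)}\sum_{j_i=0}^\infty \frac{K_i^{j_i}d_{j_i}}{j_i!\,j_i!}\,\frac{\gamma^{j_i}}{(2\sigma_i^2)^{j_i+1}}\exp\Big(-\frac{\gamma}{2\sigma_i^2}\Big),$$ and cumulative distribution function $$F_i(\gamma)=\frac{m_i^{m_i}}{\Gamma(m_i)}\sum_{j_i=0}^\infty \frac{K_i^{j_i}d_{j_i}}{j_i!\,j_i!}\,\gamma\Big(j_i+1,\frac{\gamma}{2\sigma_i^2}\Big),$$ where $\gamma(a,x)=\int_0^x t^{a-1}e^{-t}\,dt$ is the lower incomplete gamma function. The coefficients $d_{j_i}$ depend on $(m_i,K_i,\Delta_i)$ and the index $j_i$ (so $d_{j_D}$ uses the parameters of channel $D$ and $d_{j_E}$ those of channel $E$): $$d_{j_i}=\frac{\Gamma(j_i+m_i)}{\pi}\int_0^{\pi}\frac{(1+\Delta_i\cos\theta)^{j_i}}{(m_i+K_i+K_i\Delta_i\cos\theta)^{j_i+m_i}}\,d\theta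 .$$ $\Gamma(a,x)=\int_x^\infty t^{a-1}e^{-t}\,dt$ ($x>0$, $a\in\mathbb{R}$) is the upper incomplete gamma function; $\ln$ is the natural logarithm; the convention $0^0=1$ is used. *)

(* Defs.v *)
From HB Require Import structures.
From mathcomp Require Import all_boot all_order all_algebra.
From mathcomp Require Import all_classical all_reals all_analysis.
Set Implicit Arguments.
Unset Strict Implicit.
Unset Printing Implicit Defensive.
Import Order.TTheory GRing.Theory Num.Theory.
Import numFieldNormedType.Exports.

Local Open Scope classical_set_scope.
Local Open Scope ring_scope.

Definition upper_Gamma (R : realType) (a x : R) : R :=
  \int[lebesgue_measure]_(t in `]x, +oo[) (t `^ (a - 1) * expR (- t)).

(* Only meaningful for a > 0. *)
Definition Gamma (R : realType) (a : R) : R := upper_Gamma a 0.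

(* [ftr_d m K Delta j] is the coefficient d_j of the FTR fading law. The
   numerator is a natural power, so that 0 ^+ 0 = 1; the base of the real
   power is positive when m > 0, K >= 0 and 0 <= Delta <= 1. *)
Definition ftr_d (R : realType) (m K Delta : R) (j : nat) : R :=
  Gamma (j%:R + m) / pi *
  \int[lebesgue_measure]_(theta in `[0, pi])
    ((1 + Delta * cos theta) ^+ j /
     (m + K + K * Delta * cos theta) `^ (j%:R + m)).

(* The last parameter [sigma2] stands for sigma^2. *)
Definition ftr_pdf (R : realType) (m K Delta sigma2 x : R) : R :=
  m `^ m / Gamma m *
  limn (series (fun j : nat =>
    K ^+ j * ftr_d m K Delta j / (j`!%:R * j`!%:R) *
    (x ^+ j / (2 * sigma2) ^+ j.+1) * expR (- (x / (2 * sigma2))))).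

(* X has density [ftr_pdf m K Delta sigma2] on (0, +oo). *)
Definition is_ftr_snr (d : measure_display) (T : measurableType d)
    (R : realType) (P : probability T R) (X : {RV P >-> R})
    (m K Delta sigma2 : R) : Prop :=
  forall A : set R, measurable A ->
    distribution P X A =
    (\int[lebesgue_measure]_(x in A `&` `]0%R, +oo[)
       (ftr_pdf m K Delta sigma2 x)%:E)%E.

Definition independent_RVs (d : measure_display) (T : measurableType d)
    (R : realType) (P : probability T R) (X Y : {RV P >-> R}) : Prop :=
  forall A B : set R, measurable A -> measurable B ->
    P ((X @^-1` A) `&` (Y @^-1` B)) = (P (X @^-1` A) * P (Y @^-1` B))%E.

(* Only meaningful for w >= 1 and mu > 0. *)
Definition S_fun (R : realType) (w : nat) (mu : R) : R :=
  (w.-1)`!%:R * expR mu *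
  \sum_(1 <= k < w.+1) upper_Gamma (- w%:R + k%:R) mu / mu ^+ k.

(* sD and sE stand for sigma_D^2 and sigma_E^2. *)
Definition asc_term (R : realType) (mD KD DeltaD sD mE KE DeltaE sE : R)
    (jD jE : nat) : R :=
  KD ^+ jD * ftr_d mD KD DeltaD jD * KE ^+ jE * ftr_d mE KE DeltaE jE /
    (jD`!%:R * jE`!%:R) *
  (S_fun jD.+1 (2 * sD)^-1 / (jD`!%:R * (2 * sD) ^+ jD.+1)
   + S_fun jE.+1 (2 * sE)^-1 / (jE`!%:R * (2 * sE) ^+ jE.+1)
   - \sum_(0 <= n < jE.+1)
       S_fun (jD + n).+1 ((sD + sE) / (2 * sD * sE)) /
       (n`!%:R * jD`!%:R * (2 * sE) ^+ n * (2 * sD) ^+ jD.+1)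
   - \sum_(0 <= n < jD.+1)
       S_fun (jE + n).+1 ((sD + sE) / (2 * sD * sE)) /
       (n`!%:R * jE`!%:R * (2 * sD) ^+ n * (2 * sE) ^+ jE.+1)).

Definition asc_corr_term (R : realType) (mE KE DeltaE sE : R) (jE : nat) : R :=
  KE ^+ jE * ftr_d mE KE DeltaE jE * S_fun jE.+1 (2 * sE)^-1 /
    (jE`!%:R * jE`!%:R * (2 * sE) ^+ jE.+1).

(* Main.v *)
(** Writing [max (x - y) 0 = max x y - y] reduces the average secrecy capacity to
    the expectations of [ln (1 + max gD gE)] and [ln (1 + gE)], and for these the
    layer cake formula only involves tail probabilities. An FTR law is a mixture
    of gamma laws of integer shapes, whose tails are Poisson sums
    [Q_k (x) = exp (- c x) * \sum_(i <= k) (c x)^i / i!], and by independence the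
    tail of the maximum is the mixture of [Q_a + Q'_b - Q_a Q'_b]. The product
    [Q_a Q'_b] is again a combination of such Poisson sums, with rate [c + c'],
    and integrating a Poisson sum against [dx / (1 + x)] gives [S_fun]. All
    terms are nonnegative, so that sums and integrals commute; summability
    follows from [d_j] being dominated by [Gamma (j + m)] times a geometric
    sequence. *)

Require Import Defs.
From HB Require Import structures.
From mathcomp Require Import all_boot all_order all_algebra.
From mathcomp Require Import all_classical all_reals all_analysis.
From mathcomp Require Import measurable_realfun ring lra.
Set Implicit Arguments.
Unset Strict Implicit.
Unset Printing Implicit Defensive.
Import Order.TTheory GRing.Theory Num.Theory.
Import numFieldNormedType.Exports.

Local Open Scope classical_set_scope.
Local Open Scope ring_scope.

(** * Truncated exponentials as polynomials *)

Section TruncatedExponential.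
Variable R : realType.
Implicit Types (P : {poly R}) (c mu : R).

(** The logarithm is handled inside the events: [ln (1 + X) > r] iff [X > expR r - 1], so the
    integrals run over [r >= 0], with dr standing for dx / (1 + x). Poisson sums are kept as a
    polynomial times an exponential; integrating Q exp(- c x) then amounts to finding a polynomial P
    with c P - P' = Q. Integrals and limits are total functions here: [Gamma], [upper_Gamma] and the
    integral in [ftr_d] take the value 0 when the integral diverges, and [limn] is a sum only under
    convergence. Finiteness is therefore proved where a value matters, and elsewhere only upper
    bounds that survive the default value are used. A Poisson sum of index j integrates to at most
    (j + 1) / c, so the mixture weights must be summable against j + 1; being a probability vector
    is too weak for that. That they sum to 1 is not computed from the coefficients d_j but read off
    the total mass of the law. *)

Definition texp c k : {poly R} := \sum_(i < k.+1) (c ^+ i / i`!%:R) *: 'X^i.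

Lemma texpS c k :
  texp c k.+1 = texp c k + (c ^+ k.+1 / k.+1`!%:R) *: 'X^(k.+1).
Proof. by rewrite /texp big_ord_recr. Qed.

Lemma fact_neq0 k : k`!%:R != 0 :> R.
Proof. by rewrite pnatr_eq0 -lt0n fact_gt0. Qed.

Lemma factSr k : k.+1`!%:R = k.+1%:R * k`!%:R :> R.
Proof. by rewrite factS natrM. Qed.

(** Differentiation drops the top term; writing this as a correction of [c *: texp c k] keeps the
    index [k] and covers [k = 0]. *)
Lemma texp_deriv c k :
  (texp c k)^`() = c *: texp c k - (c ^+ k.+1 / k`!%:R) *: 'X^k.
Proof.
elim: k => [|k IH].
  rewrite /texp big_ord1 !expr0 fact0 expr1 invr1 !mulr1 scale1r derivC.
  by rewrite subrr.
have k1 : k.+1%:R != 0 :> R by rewrite pnatr_eq0.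
rewrite texpS derivD IH derivZ derivXn /= scalerDr -!addrA; congr (_ + _).
rewrite -scalerMnr -scaler_nat !scalerA.
rewrite [X in - X + _](_ : _ = (k.+1%:R * (c ^+ k.+1 / k.+1`!%:R)) *: 'X^k).
  by rewrite addNr mulrA -exprS subrr.
by congr (_ *: _); rewrite factSr invfM mulrCA mulVKf.
Qed.

Lemma horner_texp c k x :
  (texp c k).[x] = \sum_(i < k.+1) (c * x) ^+ i / i`!%:R.
Proof.
rewrite /texp horner_sum; apply: eq_bigr => i _.
by rewrite hornerZ hornerXn exprMn mulrAC.
Qed.

(** Differentiation lowers the size of a nonzero polynomial, while scaling by [mu != 0] preserves
    it. *)
Lemma deriv_eigen_eq0 P mu : mu != 0 -> P^`() = mu *: P -> P = 0.
Proof.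
move=> mu0 H; apply/eqP; apply: contraT => P0.
by have := lt_size_deriv P0; rewrite H size_scale// ltnn.
Qed.

(* Both sides are mapped to the same polynomial by [D - (c + c')], which is
   injective on polynomials; this stands for an integration by parts. *)
Lemma texp_mul c c' (a b : nat) : c + c' != 0 ->
  texp c a * texp c' b =
  \sum_(0 <= n < b.+1) ('C(a + n, n)%:R * c ^+ a.+1 * c' ^+ n
      / (c + c') ^+ (a + n).+1) *: texp (c + c') (a + n) +
  \sum_(0 <= n < a.+1) ('C(b + n, n)%:R * c' ^+ b.+1 * c ^+ n
      / (c + c') ^+ (b + n).+1) *: texp (c + c') (b + n).
Proof.
set mu := c + c' => mu0.
(* [D - mu] sends each [texp mu (i + n)] to a monomial; the powers of [mu] cancel and C(i + n, n) /
   (i + n)! = 1 / (i! n!), so the sum over [n] rebuilds [texp d' j]. *)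
have half (d d' : R) i j :
  (\sum_(0 <= n < j.+1) ('C(i + n, n)%:R * d ^+ i.+1 * d' ^+ n
      / mu ^+ (i + n).+1) *: texp mu (i + n))^`() =
  mu *: (\sum_(0 <= n < j.+1) ('C(i + n, n)%:R * d ^+ i.+1 * d' ^+ n
      / mu ^+ (i + n).+1) *: texp mu (i + n))
  - ((d ^+ i.+1 / i`!%:R) *: 'X^i) * texp d' j.
  rewrite raddf_sum scaler_sumr [in X in _ - X]/texp mulr_sumr -(big_mkord
    xpredT (fun n =>
     (d ^+ i.+1 / i`!%:R) *: 'X^i * ((d' ^+ n / n`!%:R) *: 'X^n))) -sumrB.
  apply: eq_bigr => n _; rewrite /= derivZ texp_deriv scalerBr !scalerA.
  rewrite [mu * _]mulrC; congr (_ - _).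
  rewrite [RHS](_ : _ = (d ^+ i.+1 / i`!%:R * (d' ^+ n / n`!%:R)) *: 'X^(i + n)).
    congr (_ *: _).
    have /(congr1 (fun n => n%:R : R)) := bin_fact (leq_addl i n).
    rewrite addnK !natrM => <-; field.
    by rewrite !fact_neq0 expf_neq0 ?andbT// pnatr_eq0 -lt0n bin_gt0 leq_addl.
  by rewrite exprD -scalerAl -scalerAr scalerA.
apply/eqP; rewrite -subr_eq0; apply/eqP; apply: (deriv_eigen_eq0 mu0).
rewrite derivB derivM derivD !half !texp_deriv /mu -!mul_polyC polyCD.
set S1 := \sum_(_ <= _ < _) _; set S2 := \sum_(_ <= _ < _) _.
by ring.
Qed.

End TruncatedExponential.

(** * Integrals of a polynomial times an exponential *)

Section PolynomialTimesExponential.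
Variable R : realType.
Notation mu := (@lebesgue_measure R).
Implicit Types (P : {poly R}) (a c x : R).

Definition poly_exp P c x : R := P.[x] * expR (- (c * x)).

Lemma is_derive_poly_exp P c x :
  is_derive x 1 (poly_exp P c) (poly_exp (P^`() - c *: P) c x).
Proof.
have dP : is_derive x 1 (horner P) (P^`()).[x].
  apply: DeriveDef; first exact: derivable_horner.
  by rewrite derivE derive1E.
have de : is_derive x 1 (fun y : R => expR (- (c * y))) (- c * expR (- (c * x))).
  have -> : (fun y : R => expR (- (c * y))) = expR \o (fun y => - (c * y)) by [].
  apply: is_derive_eq.
  by rewrite /GRing.scale /=; ring.
apply: is_derive_eq.
by rewrite /poly_exp hornerD hornerN hornerZ /GRing.scale /=; ring.
Qed.

Lemma continuous_poly_exp P c : continuous (poly_exp P c).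
Proof.
move=> x; apply: differentiable_continuous; apply/derivable1_diffP.
by have [] := is_derive_poly_exp P c x.
Qed.

Lemma measurable_poly_exp P c D : measurable_fun D (poly_exp P c).
Proof. by apply: measurable_funTS; apply: continuous_measurable_fun;
  exact: continuous_poly_exp. Qed.

(** One term of the exponential series, exp(c x) >= (c x)^(n+1) / (n+1)!, bounds the product by a
    constant over x. *)
Lemma cvg_exprn_exp c n : 0 < c -> x ^+ n * expR (- (c * x)) @[x --> +oo] --> 0.
Proof.
move=> c0.
have inv0 : n.+1`!%:R / c ^+ n.+1 * x^-1 @[x --> +oo] --> (0 : R).
  by rewrite -[X in _ --> X](mulr0 (n.+1`!%:R / c ^+ n.+1)); apply: cvgMl_tmp;
    apply/gtr0_cvgV0; [exact: nbhs_pinfty_gt|exact: cvg_id].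
apply: (squeeze_cvgr _ (cvg_cst 0) inv0).
near=> x.
have x0 : 0 < x by near: x; exact: nbhs_pinfty_gt.
rewrite mulr_ge0 ?expR_ge0 ?exprn_ge0 ?(ltW x0)//=.
rewrite expRN ler_pdivrMr ?expR_gt0//.
have := expR_ge1Dxn n (ltW (mulr_gt0 c0 x0)).
set e := expR _ => He.
have {}He : (c * x) ^+ n.+1 / n.+1`!%:R <= e by apply: le_trans He; rewrite lerDr.
rewrite -ler_pdivrMl ?mulr_gt0 ?invr_gt0 ?divr_gt0 ?exprn_gt0 ?ltr0n ?fact_gt0//.
apply: le_trans He; rewrite exprMn !exprS.
rewrite le_eqVlt; apply/orP; left; apply/eqP.

by field; rewrite fact_neq0 expf_neq0 !gt_eqF.
Unshelve. all: by end_near. Qed.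

Lemma cvg_poly_exp P c : 0 < c -> poly_exp P c x @[x --> +oo] --> 0.
Proof.
move=> c0; have -> : poly_exp P c =
    fun x => \sum_(i < size P) P`_i * (x ^+ i * expR (- (c * x))).
  apply/funext => x; rewrite /poly_exp horner_coef mulr_suml.
  by apply: eq_bigr => i _; rewrite mulrA.
rewrite [X in _ --> X](_ : 0 = \sum_(i < size P) P`_i * 0); last first.
  by rewrite big1// => i _; rewrite mulr0.
apply: (@cvg_big R _ +%R 0 xpredT (@add_continuous R)) => i _.
by apply: cvgMl_tmp; exact: cvg_exprn_exp.
Qed.

(** The integrand is parametrised by its primitive, minus [poly_exp P c], which replaces repeated
    integration by parts. Its sign is assumed because the fundamental theorem on a half-line is
    applied to a nonnegative integrand. *)
Lemma integral_poly_exp P c a : 0 < c ->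
  (forall x, a <= x -> 0 <= (c *: P - P^`()).[x]) ->
  (\int[mu]_(x in `[a, +oo[) (poly_exp (c *: P - P^`()) c x)%:E
    = (poly_exp P c a)%:E)%E.
Proof.
move=> c0 p0.
have dF x : is_derive x 1 (fun y =>
  - poly_exp P c y) (poly_exp (c *: P - P^`()) c x).
  have := is_derive_poly_exp P c x => ?.
  apply: is_derive_eq.
  by rewrite -mulNr -hornerN opprB.
rewrite (@ge0_continuous_FTC2y _ _ (fun x => - poly_exp P c x) _ 0)//.
- by rewrite sub0e -EFinN opprK.
- by move=> x ax; rewrite mulr_ge0 ?expR_ge0// p0.
- apply: continuous_subspaceT => x; exact: continuous_poly_exp.
- by rewrite -oppr0; apply: cvgN; exact: cvg_poly_exp.
- by apply/cvg_at_right_filter; apply: cvgN; exact: continuous_poly_exp.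
- by move=> x _; rewrite derive1E; have [_ ->] := dF x.
Qed.

End PolynomialTimesExponential.

(** * The upper incomplete gamma function at nonpositive integers *)

Section UpperGammaNegative.
Variable R : realType.
Notation mu := (@lebesgue_measure R).
Implicit Types (a c x m : R).

(** The two summands are the integrands of [upper_Gamma] at -(n+1), up to the factor n+1, and at -n;
    integrating gives the recurrence between them. *)
Lemma is_derive_expN_over_exprn n x : x != 0 ->
  is_derive x 1 (fun t : R => - (expR (- t) / t ^+ n.+1))
    (n.+1%:R * (expR (- x) / x ^+ n.+2) + expR (- x) / x ^+ n.+1).
Proof.
move=> x0.
have xn0 : x ^+ n.+1 != 0 by rewrite expf_neq0.
have dV : is_derive x 1 (fun t : R => (t ^+ n.+1)^-1)
    (- (x ^+ n.+1) ^- 2 * (n.+1%:R * x ^+ n)).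
  have dX : is_derive x 1 (fun t : R => t ^+ n.+1) (n.+1%:R * x ^+ n).
    have := @is_deriveX R R id n.+1 x 1 1 (is_derive_id x 1).
    by rewrite exprfctE /GRing.scale /= mulr1.
  have H := is_deriveV (f := fun t : R => t ^+ n.+1) xn0 dX.
  apply: is_derive_eq.
  by rewrite /GRing.scale /=; ring.
have de : is_derive x 1 (fun y : R => expR (- y)) (- expR (- x)).
  have -> : (fun y : R => expR (- y)) = expR \o (fun y => - y) by [].
  apply: is_derive_eq.
  by rewrite /GRing.scale /=; ring.
have -> : (fun t : R => - (expR (- t) / t ^+ n.+1)) =
   - ((fun t : R => expR (- t)) * (fun t : R => (t ^+ n.+1)^-1)) by [].
apply: is_derive_eq.
rewrite /GRing.scale /= !exprS; field.
by rewrite expf_neq0.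
Qed.

Lemma continuous_expN_over_exprn n x : x != 0 ->
  {for x, continuous (fun t : R => expR (- t) / t ^+ n.+1)}.
Proof.
move=> x0; apply: differentiable_continuous; apply/derivable1_diffP.
have [dF _] := is_derive_expN_over_exprn n x0.
rewrite [X in derivable X](_ : _ = - (fun t : R => - (expR (- t) / t ^+ n.+1))).
  exact: derivableN.
by apply/funext => t; rewrite fctE opprK.
Qed.

Lemma continuous_within_expN_over_exprn n a : 0 < a ->
  {within `[a, +oo[, continuous (fun t : R => expR (- t) / t ^+ n.+1)}.
Proof.
move=> a0; apply: continuous_in_subspaceT => x.
rewrite inE/= in_itv/= andbT => ax.
by apply: continuous_expN_over_exprn; rewrite gt_eqF// (lt_le_trans a0).
Qed.

Lemma measurable_expN_over_exprn n a : 0 < a ->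
  measurable_fun `[a, +oo[ (fun t : R => expR (- t) / t ^+ n.+1).
Proof.
move=> a0; apply: subspace_continuous_measurable_fun => //.
exact: continuous_within_expN_over_exprn.
Qed.

Lemma integral_expN a :
  (\int[mu]_(x in `[a, +oo[) (expR (- x))%:E = (expR (- a))%:E)%E.
Proof.
have pE x : poly_exp 1 1 x = expR (- x) by rewrite /poly_exp hornerC !mul1r.
have p1 : 1 *: 1 - (1 : {poly R})^`() = 1 by rewrite derivC scale1r subr0.
have := @integral_poly_exp R 1 1 a ltr01; rewrite p1 pE => <-.
  by apply: eq_integral => x _; rewrite pE.
by move=> x _; rewrite hornerC.
Qed.

(** [upper_Gamma] is the real part of an extended integral, so finiteness has to be shown: on [[m,
    +oo[] the integrand is at most m^-(n+1) exp(- t). *)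
Lemma upper_Gamma_negE n m : 0 < m ->
  (\int[mu]_(t in `[m, +oo[) (expR (- t) / t ^+ n.+1)%:E =
    (upper_Gamma (- n%:R) m)%:E)%E.
Proof.
move=> m0.
have pos t : m <= t -> 0 < t by exact: lt_le_trans.
have mf : measurable_fun `]m, +oo[ (fun t : R => expR (- t) / t ^+ n.+1).
  apply: measurable_funS (measurable_expN_over_exprn n m0) => //.
  by apply: subset_itvr; rewrite bnd_simp.
have fin : (\int[mu]_(t in `[m, +oo[) (expR (- t) / t ^+ n.+1)%:E < +oo)%E.
  apply: (@le_lt_trans _ _ (\int[mu]_(t in `[m, +oo[)
      ((m ^+ n.+1)^-1%:E * (expR (- t))%:E))%E).
    apply: ge0_le_integral => //=.
    - by move=> x /=; rewrite in_itv/= andbT => /pos x0;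
        rewrite lee_fin divr_ge0 ?expR_ge0 ?exprn_ge0 ?ltW.
    - by apply/measurable_EFinP; exact: measurable_expN_over_exprn.
    - apply/measurable_EFinP; apply: measurable_funM => //.
      by apply: measurableT_comp.
    - move=> x /=; rewrite in_itv/= andbT => mx.
      rewrite -EFinM lee_fin mulrC ler_wpM2r ?expR_ge0// lef_pV2 ?posrE
        ?exprn_gt0 ?pos//.
      by rewrite lerXn2r// nnegrE ltW ?pos.
  rewrite ge0_integralZl_EFin//; last first.
  - by rewrite invr_ge0 exprn_ge0 ?ltW.
  - by apply/measurable_EFinP; apply: measurableT_comp.
  by rewrite integral_expN -EFinM ltry.
have E : (\int[mu]_(t in `]m, +oo[) (t `^ (- n%:R - 1) * expR (- t))%:E =
          \int[mu]_(t in `[m, +oo[) (expR (- t) / t ^+ n.+1)%:E)%E.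
  rewrite -integral_itv_obnd_cbnd; last exact/measurable_EFinP.
  apply: eq_integral => t; rewrite inE/= in_itv/= andbT => /ltW/pos t0.
  rewrite mulrC; congr (_ * _)%:E.
  have -> : - n%:R - 1 = - n.+1%:R :> R by rewrite -opprD natr1.
  by rewrite powR_invn ?ltW.
rewrite /upper_Gamma /Rintegral E fineK// ge0_fin_numE//.
apply: integral_ge0 => t /=.
by rewrite in_itv/= andbT => /pos t0;
  rewrite lee_fin divr_ge0 ?expR_ge0 ?exprn_ge0 ?ltW.
Qed.

(** The classical recurrence Gamma(a+1, x) = a Gamma(a, x) + x^a exp(- x) at a = -(n+1). *)
Lemma upper_Gamma_negS n m : 0 < m ->
  n.+1%:R * upper_Gamma (- n.+1%:R) m + upper_Gamma (- n%:R) m =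
  expR (- m) / m ^+ n.+1.
Proof.
move=> m0.
have pos t : m <= t -> 0 < t by exact: lt_le_trans.
have ge0 k t : m <= t -> 0 <= expR (- t) / t ^+ k.
  by move=> /pos t0; rewrite divr_ge0 ?expR_ge0 ?exprn_ge0 ?ltW.
have := @ge0_continuous_FTC2y R
  (fun t => n.+1%:R * (expR (- t) / t ^+ n.+2) + expR (- t) / t ^+ n.+1)
  (fun t => - (expR (- t) / t ^+ n.+1)) m 0.
rewrite sub0e -EFinN opprK.
under eq_integral do rewrite EFinD EFinM.
rewrite ge0_integralD//=; last 4 first.
- by move=> x; rewrite in_itv/= andbT => mx; rewrite -EFinM lee_fin mulr_ge0 ?ge0.
- apply/measurable_EFinP; apply: measurable_funM => //.
  exact: measurable_expN_over_exprn.
- by move=> x; rewrite in_itv/= andbT => mx; rewrite lee_fin ge0.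
- by apply/measurable_EFinP; exact: measurable_expN_over_exprn.
rewrite ge0_integralZl_EFin//; last 2 first.
- by move=> x /=; rewrite in_itv/= andbT => mx; rewrite lee_fin ge0.
- by apply/measurable_EFinP; exact: measurable_expN_over_exprn.
rewrite !upper_Gamma_negE// -EFinM -EFinD => H.
apply: EFin_inj; apply: H.
- move=> x mx; apply: addr_ge0; last exact: ge0.
  by apply: mulr_ge0; [exact: ler0n|exact: ge0].
- apply: continuous_in_subspaceT => x.
  rewrite inE/= in_itv/= andbT => /pos/lt0r_neq0 x0.
  by apply: cvgD; [apply: cvgMl_tmp|]; exact: continuous_expN_over_exprn.
- rewrite -oppr0; apply: cvgN.
  apply: (@squeeze_cvgr _ _ _ _ (fun=> 0) (fun t : R =>
    (m ^+ n.+1)^-1 * expR (- t))).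
  + near=> x.
    have mx : m <= x by near: x; apply: nbhs_pinfty_ge; exact: num_real.
    rewrite ge0//= mulrC ler_wpM2r ?expR_ge0// lef_pV2 ?posrE ?exprn_gt0 ?pos//.
    by rewrite lerXn2r// nnegrE ltW ?pos.
  + exact: cvg_cst.
  + rewrite -[X in _ --> X](mulr0 (m ^+ n.+1)^-1).
    by apply: cvgMl_tmp; exact: cvgr_expR.
- by move=> x /ltW/pos/lt0r_neq0 x0; have [] := is_derive_expN_over_exprn n x0.
- apply/cvg_at_right_filter; apply: cvgN.
  by apply: continuous_expN_over_exprn; rewrite gt_eqF.
- move=> x; rewrite in_itv/= andbT => /ltW/pos/lt0r_neq0 x0.
  by rewrite derive1E; have [_ ->] := is_derive_expN_over_exprn n x0.
Unshelve. all: by end_near. Qed.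


End UpperGammaNegative.

(** * Moments against dx / (1 + x), in the variable r = ln (1 + x) *)

Section LogMoments.
Variable R : realType.
Notation mu := (@lebesgue_measure R).
Implicit Types (P : {poly R}) (c r : R).

Lemma expRB1_ge0 r : 0 <= r -> 0 <= expR r - 1.
Proof. by move=> r0; rewrite subr_ge0 -expR0 ler_expR. Qed.

Lemma continuous_expRB1 : continuous (fun r : R => expR r - 1).
Proof. by move=> r; apply: cvgB; [exact: continuous_expR|exact: cvg_cst]. Qed.

Lemma continuous_poly_exp_expRB1 P c :
  continuous (fun r : R => poly_exp P c (expR r - 1)).
Proof.
move=> r; apply: (@continuous_comp _ _ _ (fun r : R => expR r - 1)).
  exact: continuous_expRB1.
exact: continuous_poly_exp.
Qed.

Lemma measurable_poly_exp_expRB1 P c D :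
  measurable_fun D (fun r : R => poly_exp P c (expR r - 1)).
Proof.
by apply: measurable_funTS; apply: continuous_measurable_fun;
  exact: continuous_poly_exp_expRB1.
Qed.

(** The integral of [integral_poly_exp] from 0, after x = exp(r) - 1; the factor [expR r] is the
    Jacobian. *)
Lemma integral_poly_exp_expRB1 P c : 0 < c ->
  (forall x, 0 <= x -> 0 <= (c *: P - P^`()).[x]) ->
  (\int[mu]_(r in `[0%R, +oo[)
     (poly_exp (c *: P - P^`()) c (expR r - 1) * expR r)%:E = (P.[0])%:E)%E.
Proof.
move=> c0 p0.
have dF r : is_derive r 1 (fun y => - poly_exp P c (expR y - 1))
    (poly_exp (c *: P - P^`()) c (expR r - 1) * expR r).
  have dP := is_derive_poly_exp P c (expR r - 1).
  have de : is_derive r 1 (fun y : R => expR y - 1) (expR r).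
    by apply: is_derive_eq; rewrite subr0.
  have := @is_derive1_comp R (poly_exp P c) (fun y : R => expR y - 1) r _ _ dP de.
  move=> /(@is_deriveN R R R _ r 1 _) H.
  apply: is_derive_eq.
  by rewrite -mulNr -[- poly_exp _ _ _]mulNr -hornerN opprB.
rewrite (@ge0_continuous_FTC2y _ _ (fun r => - poly_exp P c (expR r - 1)) _ 0)//.
- by rewrite sub0e -EFinN opprK expR0 subrr /poly_exp mulr0 oppr0 expR0 mulr1.
- move=> r r0; apply: mulr_ge0; last exact: expR_ge0.
  by apply: mulr_ge0; [exact/p0/expRB1_ge0|exact: expR_ge0].
- apply: continuous_subspaceT => r; apply: cvgM; last exact: continuous_expR.
  exact: continuous_poly_exp_expRB1.
- rewrite -oppr0; apply: cvgN.
  apply: (@cvg_comp _ _ _ (fun r => expR r - 1) (poly_exp P c) _ (pinfty_nbhs R)).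
    apply: (@ger_cvgy _ _ _ _ id); last exact: cvg_id.
    by near=> r; rewrite lerBrDl expR_ge1Dx.
  exact: cvg_poly_exp.
- apply/cvg_at_right_filter; apply: cvgN.
  exact: continuous_poly_exp_expRB1.
- by move=> x _; rewrite derive1E; have [_ ->] := dF x.
Unshelve. all: by end_near. Qed.

(** After multiplication by exp(- c x): the Poisson sum is minus a primitive of the gamma density of
    shape k + 1 and rate c. *)
Lemma gamma_tail_primitive c k :
  c *: texp c k - (texp c k)^`() = (c ^+ k.+1 / k`!%:R) *: 'X^k.
Proof. by rewrite texp_deriv opprB addrCA subrr addr0. Qed.

(* [n`! * expR c * upper_Gamma (- n) c] is [\int_0^oo x^n exp (- c x) / (1 + x)];
   here [x = expR r - 1], so that [dx / (1 + x) = dr]. *)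
Lemma log_moment c n : 0 < c ->
  (\int[mu]_(r in `[0%R, +oo[) (poly_exp 'X^n c (expR r - 1))%:E =
   (n`!%:R * expR c * upper_Gamma (- n%:R) c)%:E)%E.
Proof.
move=> c0; elim: n => [|n IH].
(* The substitution r = ln t - ln c, that is t = c exp(r), turns - c (exp(r) - 1) into c - t and
   sends t = c to r = 0. *)
- have F0 : ln c - ln c = 0 :> R by rewrite subrr.
  have := @increasing_ge0_integration_by_substitutiony R
    (fun t : R => ln t - ln c) (fun r => poly_exp 1 c (expR r - 1)) c.
  have pos t : c <= t -> 0 < t by exact: lt_le_trans.
  have dF (t : R) : 0 < t -> is_derive t (1 : R) (fun t : R => ln t - ln c) t^-1.
    move=> t0; have := is_derive1_ln t0 => ?.
    by apply: is_derive_eq; rewrite subr0.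
  have F'E (t : R) : 0 < t -> ((fun t : R => ln t - ln c)^`())%classic t = t^-1.
    by move=> /dF dt; rewrite derive1E; have [_ ->] := dt.
  rewrite F0 expr0 => ->.
  + rewrite fact0 mul1r EFinM -upper_Gamma_negE// -ge0_integralZl_EFin
    ?expR_ge0//; last 2 first.
    * move=> t /=; rewrite in_itv/= andbT => /pos t0.
      by rewrite lee_fin divr_ge0 ?expR_ge0 ?exprn_ge0 ?ltW.
    * by apply/measurable_EFinP; exact: measurable_expN_over_exprn.
    apply: eq_integral => t; rewrite inE/= in_itv/= andbT => /pos t0.
    rewrite fctE /= F'E// /poly_exp -polyC1 hornerC mul1r -EFinM expr1 mulrA
      -expRD; congr (expR _ / _)%:E.
    rewrite expRB !lnK ?posrE// mulrBr mulr1 mulrCA divff ?gt_eqF//; ring.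
  + move=> x y; rewrite !in_itv/= !andbT => /pos x0 /pos y0 xy.
    by rewrite ltrD2r ltr_ln ?posrE.
  + move=> x; rewrite in_itv/= andbT => /ltW/pos x0.
    rewrite /continuous_at F'E//; apply: (cvg_trans (near_eq_cvg _)); last first.
      by apply: cvgV; [rewrite gt_eqF|exact: cvg_id].
    by near=> t; rewrite F'E//; near: t; exact: lt_nbhsr.
  + apply/cvg_ex; exists c^-1.
    apply: (cvg_trans (near_eq_cvg _)); last first.
      by apply/cvg_at_right_filter; apply: cvgV; [rewrite gt_eqF|exact: cvg_id].
    by near=> t; rewrite F'E// (lt_trans c0).
  + apply/cvg_ex; exists 0.
    apply: (cvg_trans (near_eq_cvg _)); last first.
      by apply/gtr0_cvgV0; [exact: nbhs_pinfty_gt|exact: cvg_id].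
    by near=> t; rewrite F'E//; near: t; exact: nbhs_pinfty_gt.
  + split.
      by move=> t; rewrite in_itv/= andbT => /ltW/pos/dF[].
    apply/cvg_at_right_filter; apply: cvgB; last exact: cvg_cst.
    exact: continuous_ln.
  + apply/cvgryPge => A; near=> t.
    have t0 : 0 < t by near: t; exact: nbhs_pinfty_gt.
    have tA : expR (A + ln c) <= t.
      by near: t; apply: nbhs_pinfty_ge; exact: num_real.
    by rewrite lerBrDr -(expRK (A + ln c)) ler_ln ?posrE ?expR_gt0.
  + apply: continuous_subspaceT => r; exact: continuous_poly_exp_expRB1.
  + by move=> r _; rewrite /poly_exp -polyC1 hornerC mul1r expR_ge0.
(* Since x^n + x^(n+1) = x^n exp(r), the Jacobian appears and the sum of two consecutive moments is
   the elementary n! / c^(n+1). *)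
- have S : (\int[mu]_(r in `[0%R, +oo[) (poly_exp 'X^n c (expR r - 1))%:E +
      \int[mu]_(r in `[0%R, +oo[) (poly_exp 'X^(n.+1) c (expR r - 1))%:E =
      (n`!%:R / c ^+ n.+1)%:E)%E.
    have nf : c ^+ n.+1 / n`!%:R != 0 by rewrite mulf_neq0 ?invr_eq0 ?fact_neq0
      ?expf_neq0 ?gt_eqF.
    have pE : c *: ((n`!%:R / c ^+ n.+1) *: texp c n)
      - ((n`!%:R / c ^+ n.+1) *: texp c n)^`() = 'X^n.
      rewrite derivZ scalerA mulrC -scalerA -scalerBr gamma_tail_primitive scalerA.
      by rewrite -invf_div mulVf ?scale1r.
    rewrite -ge0_integralD//=; last 4 first.
    + move=> r; rewrite in_itv/= andbT => /expRB1_ge0 r0.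
      by rewrite lee_fin mulr_ge0 ?expR_ge0// hornerXn exprn_ge0.
    + by apply/measurable_EFinP; exact: measurable_poly_exp_expRB1.
    + move=> r; rewrite in_itv/= andbT => /expRB1_ge0 r0.
      by rewrite lee_fin mulr_ge0 ?expR_ge0// hornerXn exprn_ge0.
    + by apply/measurable_EFinP; exact: measurable_poly_exp_expRB1.
    have := @integral_poly_exp_expRB1 ((n`!%:R / c ^+ n.+1) *: texp c n) c c0.
    rewrite pE => H.
    rewrite (_ : n`!%:R / c ^+ n.+1 = ((n`!%:R / c ^+ n.+1) *: texp c n).[0]);
      last first.
      rewrite hornerZ horner_texp big_ord_recl big1 ?mulr0 ?addr0 ?expr0 ?fact0
        ?divr1 ?mulr1//.
      by move=> i _; rewrite expr0n mul0r.
    rewrite -H; last by move=> x x0; rewrite hornerXn exprn_ge0.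
    apply: eq_integral => r _; rewrite -EFinD /poly_exp !hornerXn exprS;
      congr EFin; ring.
  rewrite IH in S.
  have {}S := congr1 (fun z =>
    z - (n`!%:R * expR c * upper_Gamma (- n%:R) c)%:E)%E S.
  rewrite addeAC subee// add0e in S.
  rewrite S -EFinB; congr EFin.
  (* The moments and the incomplete gamma functions satisfy the same recurrence, which closes the
     induction. *)
  have G := upper_Gamma_negS n c0.
  have -> : upper_Gamma (- n%:R) c = expR (- c) / c ^+ n.+1 - n.+1%:R *
    upper_Gamma (- n.+1%:R) c.
    by rewrite -G addrAC subrr add0r.
  rewrite factSr expRN; field.
  by rewrite ?expf_neq0 !gt_eqF ?expR_gt0.
Unshelve. all: by end_near. Qed.

End LogMoments.

(** * Gamma laws of integer shape: densities, tails and their integrals *)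

Section GammaTail.
Variable R : realType.
Notation mu := (@lebesgue_measure R).
Implicit Types (c r t x : R) (a b k : nat).

Definition gamma_pdf c k x : R :=
  poly_exp ((c ^+ k.+1 / k`!%:R) *: 'X^k) c x.

Definition gamma_tail c k x : R := poly_exp (texp c k) c x.

(** The integral of the Poisson sum against dx / (1 + x), kept in terms of [S_fun] so as to match
    the terms of the secrecy formula. *)
Definition tail_integral c k : R := S_fun k.+1 c * c ^+ k.+1 / k`!%:R.

Lemma gamma_pdfE c k x :
  gamma_pdf c k x = c * ((c * x) ^+ k / k`!%:R * expR (- (c * x))).
Proof. by rewrite /gamma_pdf /poly_exp hornerZ hornerXn exprMn exprS; ring. Qed.

Lemma gamma_pdf_ge0 c k x : 0 <= c -> 0 <= x -> 0 <= gamma_pdf c k x.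
Proof.
move=> c0 x0; rewrite gamma_pdfE mulr_ge0// mulr_ge0 ?expR_ge0//.
by rewrite divr_ge0// exprn_ge0// mulr_ge0.
Qed.

(** From y^k / k! <= exp(y). The bound is uniform in [k] and [x], so a summable weight sequence
    makes the density series converge. *)
Lemma gamma_pdf_le c k x : 0 <= c -> 0 <= x -> gamma_pdf c k x <= c.
Proof.
move=> c0 x0; rewrite gamma_pdfE ler_piMr// expRN ler_pdivrMr ?expR_gt0// mul1r.
case: k => [|k].
  by rewrite expr0 fact0 divr1 -expR0 ler_expR mulr_ge0.
by apply: le_trans (expR_ge1Dxn k (mulr_ge0 c0 x0)); rewrite lerDr.
Qed.

Lemma gamma_tail_ge0 c k x : 0 <= c -> 0 <= x -> 0 <= gamma_tail c k x.
Proof.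
move=> c0 x0; rewrite mulr_ge0 ?expR_ge0// horner_texp sumr_ge0// => i _.
by rewrite divr_ge0// exprn_ge0// mulr_ge0.
Qed.

Lemma gamma_tail_at0 c k : gamma_tail c k 0 = 1.
Proof.
rewrite /gamma_tail /poly_exp mulr0 oppr0 expR0 mulr1 horner_texp.
rewrite big_ord_recl big1 ?addr0 ?mulr0 ?expr0 ?fact0 ?divr1//.
by move=> i _; rewrite expr0n mul0r.
Qed.

Lemma integral_gamma_pdf c k t : 0 < c -> 0 <= t ->
  (\int[mu]_(x in `[t, +oo[) (gamma_pdf c k x)%:E = (gamma_tail c k t)%:E)%E.
Proof.
move=> c0 t0; rewrite /gamma_pdf -gamma_tail_primitive integral_poly_exp//.
move=> x /(le_trans t0) x0; rewrite gamma_tail_primitive hornerZ hornerXn.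
by rewrite mulr_ge0 ?divr_ge0 ?exprn_ge0 ?(ltW c0).
Qed.

(** The tails at [t] and at 0 are integrals of the same nonnegative density over nested half-lines,
    and the tail at 0 is 1. *)
Lemma gamma_tail_le1 c k t : 0 < c -> 0 <= t -> gamma_tail c k t <= 1.
Proof.
move=> c0 t0; rewrite -(gamma_tail_at0 c k) -lee_fin -!integral_gamma_pdf//.
apply: ge0_subset_integral => //=.
- by apply/measurable_EFinP; exact: measurable_poly_exp.
- by move=> x; rewrite in_itv/= andbT => x0;
    rewrite lee_fin gamma_pdf_ge0 ?(ltW c0).
- by apply: subset_itvr; rewrite bnd_simp.
Qed.

Lemma measurable_gamma_tail_expRB1 c k D :
  measurable_fun D (fun r : R => gamma_tail c k (expR r - 1)).
Proof. exact: measurable_poly_exp_expRB1. Qed.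

(** Reversing the sum in [S_fun] by i = w - k, with w = k.+1 on the left, exhibits it as the
    logarithmic moments of the Poisson sum, term by term. *)
Lemma tail_integralE c k : c != 0 -> tail_integral c k =
  \sum_(i < k.+1) c ^+ i / i`!%:R * (i`!%:R * expR c * upper_Gamma (- i%:R) c).
Proof.
move=> c0; rewrite /tail_integral /S_fun big_add1 big_nat_rev big_mkord /=.
rewrite mulr_sumr !mulr_suml; apply: eq_bigr => i _.
have ik : (i <= k)%N by rewrite -ltnS.
rewrite add0n subSS (_ : - k.+1%:R + _ = - i%:R); last first.
  by rewrite -subSn// natrB ?(leq_trans ik)// addrA addNr add0r.
have -> : c ^+ k.+1 = c ^+ i * c ^+ (k - i).+1 by rewrite -exprD addnS subnKC.
by field; rewrite !fact_neq0 expf_neq0.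
Qed.

Lemma integral_gamma_tail c k : 0 < c ->
  (\int[mu]_(r in `[0%R, +oo[) (gamma_tail c k (expR r - 1))%:E =
   (tail_integral c k)%:E)%E.
Proof.
move=> c0; rewrite tail_integralE ?gt_eqF// -sumEFin.
under [RHS]eq_bigr => i _.
  rewrite EFinM -log_moment// -ge0_integralZl_EFin//; last 3 first.
  - move=> r; rewrite /= in_itv/= andbT => /expRB1_ge0 r0.
    by rewrite lee_fin mulr_ge0 ?expR_ge0// hornerXn exprn_ge0.
  - by apply/measurable_EFinP; exact: measurable_poly_exp_expRB1.
  - by rewrite divr_ge0 ?exprn_ge0 ?(ltW c0).
  over.
rewrite -ge0_integral_sum//; last 2 first.
- move=> i; apply/measurable_EFinP; apply: measurable_funM => //.
  exact: measurable_poly_exp_expRB1.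
- move=> i r; rewrite /= in_itv/= andbT => /expRB1_ge0 r0.
  rewrite -EFinM lee_fin mulr_ge0//.
    by rewrite divr_ge0 ?exprn_ge0 ?(ltW c0).
  by rewrite mulr_ge0 ?expR_ge0// hornerXn exprn_ge0.
apply: eq_integral => r _; rewrite sumEFin; congr EFin.
rewrite /gamma_tail /poly_exp horner_texp mulr_suml; apply: eq_bigr => i _.
by rewrite hornerXn exprMn; ring.
Qed.

Lemma tail_integral_ge0 c k : 0 < c -> 0 <= tail_integral c k.
Proof.
move=> c0; rewrite -lee_fin -integral_gamma_tail//; apply: integral_ge0 => r /=.
by rewrite in_itv/= andbT => /expRB1_ge0 r0;
  rewrite lee_fin gamma_tail_ge0 ?(ltW c0).
Qed.

(** Bounding 1 / (1 + x) by 1 leaves the integral of the tail, which is the mean (k + 1) / c of the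
    gamma law. In the variable r this means inserting [expR r >= 1]. *)
Lemma tail_integral_le c k : 0 < c -> tail_integral c k <= k.+1%:R / c.
Proof.
(* P is chosen with c P - P' = [texp c k]: each [texp c i] contributes one monomial of it, and each
   equals 1 at 0. *)
move=> c0; pose P := c^-1 *: \sum_(i < k.+1) texp c i.
have pE : c *: P - P^`() = texp c k.
  rewrite /P derivZ scalerA mulrC -scalerA -scalerBr scaler_sumr raddf_sum -sumrB.
  rewrite scaler_sumr; apply: eq_bigr => i _.
  rewrite /= gamma_tail_primitive scalerA exprS.
  by congr (_ *: _); rewrite -mulrA mulKf ?gt_eqF.
have p0 x : 0 <= x -> 0 <= (c *: P - P^`()).[x].
  move=> x0; rewrite pE horner_texp sumr_ge0// => i _.
  by rewrite divr_ge0// exprn_ge0// mulr_ge0 ?(ltW c0).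
have -> : k.+1%:R / c = P.[0].
  rewrite /P hornerZ horner_sum mulrC; congr (_ * _).
  rewrite -[k.+1 in LHS](card_ord k.+1) -sumr_const; apply: eq_bigr => i _.
  by rewrite -(gamma_tail_at0 c i) /gamma_tail /poly_exp mulr0 oppr0 expR0 mulr1.
rewrite -lee_fin -integral_gamma_tail// -(integral_poly_exp_expRB1 c0 p0) pE.
apply: ge0_le_integral => //=.
- move=> r; rewrite /= in_itv/= andbT => /expRB1_ge0 r0.
  by rewrite lee_fin gamma_tail_ge0 ?(ltW c0).
- by apply/measurable_EFinP; exact: measurable_gamma_tail_expRB1.
- apply/measurable_EFinP; apply: measurable_funM.
    exact: measurable_poly_exp_expRB1.
  by apply: measurable_funTS; exact: measurable_expR.
- move=> r; rewrite /= in_itv/= andbT => r0; rewrite lee_fin ler_peMr//.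
    by apply: gamma_tail_ge0; [exact: ltW|exact: expRB1_ge0].
  by rewrite -subr_ge0 expRB1_ge0.
Qed.

Definition max_tail c c' a b x :=
  gamma_tail c a x + gamma_tail c' b x - gamma_tail c a x * gamma_tail c' b x.

(** The large bracket of the secrecy formula, with [c] and [c'] for the inverse scales 1 / (2
    sigma^2). *)
Definition max_integral c c' a b :=
  tail_integral c a + tail_integral c' b
  - \sum_(0 <= n < b.+1) S_fun (a + n).+1 (c + c') * (c ^+ a.+1 * c' ^+ n) /
      (n`!%:R * a`!%:R)
  - \sum_(0 <= n < a.+1) S_fun (b + n).+1 (c + c') * (c' ^+ b.+1 * c ^+ n) /
      (n`!%:R * b`!%:R).

(** This form is affine in the second tail with a nonnegative slope: it gives the sign, and it lets
    a double mixture be summed one index at a time. *)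
Lemma max_tailE c c' a b x :
  max_tail c c' a b x =
  gamma_tail c a x + (1 - gamma_tail c a x) * gamma_tail c' b x.
Proof. by rewrite /max_tail; ring. Qed.

Lemma max_tail_ge0 c c' a b x : 0 < c -> 0 < c' -> 0 <= x ->
  0 <= max_tail c c' a b x.
Proof.
move=> c0 c'0 x0; rewrite max_tailE; apply: addr_ge0.
  by rewrite gamma_tail_ge0 ?(ltW c0).
apply: mulr_ge0; first by rewrite subr_ge0 gamma_tail_le1.
by rewrite gamma_tail_ge0 ?(ltW c'0).
Qed.

Lemma gamma_tail_mul c c' a b x : c + c' != 0 ->
  gamma_tail c a x * gamma_tail c' b x =
  \sum_(0 <= n < b.+1) 'C(a + n, n)%:R * c ^+ a.+1 * c' ^+ n
      / (c + c') ^+ (a + n).+1 * gamma_tail (c + c') (a + n) x +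
  \sum_(0 <= n < a.+1) 'C(b + n, n)%:R * c' ^+ b.+1 * c ^+ n
      / (c + c') ^+ (b + n).+1 * gamma_tail (c + c') (b + n) x.
Proof.
move=> c0; rewrite /gamma_tail /poly_exp.
transitivity ((texp c a * texp c' b).[x] * expR (- ((c + c') * x))).
  by rewrite hornerM mulrDl opprD expRD; ring.
rewrite texp_mul// hornerD !horner_sum mulrDl !mulr_suml.
by congr (_ + _); apply: eq_bigr => n _; rewrite hornerZ mulrA.
Qed.

Lemma integral_gamma_tail_mul c c' a b : 0 < c -> 0 < c' ->
  (\int[mu]_(r in `[0%R, +oo[)
     (gamma_tail c a (expR r - 1) * gamma_tail c' b (expR r - 1))%:E =
  (\sum_(0 <= n < b.+1) S_fun (a + n).+1 (c + c') * (c ^+ a.+1 * c' ^+ n) /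
      (n`!%:R * a`!%:R) +
  \sum_(0 <= n < a.+1) S_fun (b + n).+1 (c + c') * (c' ^+ b.+1 * c ^+ n) /
      (n`!%:R * b`!%:R))%:E)%E.
Proof.
move=> c0 c'0; have m0 : 0 < c + c' by rewrite addr_gt0.
have coef_ge0 d d' i n : 0 < d -> 0 < d' ->
    0 <= 'C(i + n, n)%:R * d ^+ i.+1 * d' ^+ n / (c + c') ^+ (i + n).+1.
  by move=> d0 d'0; rewrite !mulr_ge0 ?invr_ge0 ?exprn_ge0 ?(ltW d0) ?(ltW d'0)
    ?(ltW m0).
have half d d' i j : 0 < d -> 0 < d' ->
  (\int[mu]_(r in `[0%R, +oo[)
    (\sum_(0 <= n < j.+1) 'C(i + n, n)%:R * d ^+ i.+1 * d' ^+ n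
      / (c + c') ^+ (i + n).+1 * gamma_tail (c + c') (i + n) (expR r - 1))%:E =
   (\sum_(0 <= n < j.+1) S_fun (i + n).+1 (c + c') * (d ^+ i.+1 * d' ^+ n) /
      (n`!%:R * i`!%:R))%:E)%E.
  move=> d0 d'0; under eq_integral do rewrite -sumEFin.
  rewrite ge0_integral_sum//; last 2 first.
  - move=> n; apply/measurable_EFinP; apply: measurable_funM => //.
    exact: measurable_gamma_tail_expRB1.
  - move=> n r; rewrite /= in_itv/= andbT => /expRB1_ge0 r0.
    by rewrite lee_fin mulr_ge0 ?coef_ge0// gamma_tail_ge0 ?(ltW m0).
  rewrite -sumEFin; apply: eq_bigr => n _.
  under eq_integral do rewrite EFinM.
  rewrite ge0_integralZl_EFin ?coef_ge0//; last 2 first.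
  - move=> r; rewrite /= in_itv/= andbT => /expRB1_ge0 r0.
    by rewrite lee_fin gamma_tail_ge0 ?(ltW m0).
  - by apply/measurable_EFinP; exact: measurable_gamma_tail_expRB1.
  rewrite integral_gamma_tail// -EFinM /tail_integral; congr EFin.
  (* C(i + n, n) / (i + n)! = 1 / (i! n!), and the powers of c + c' cancel against those in
     [tail_integral]. *)
  have /(congr1 (fun n => n%:R : R)) := bin_fact (leq_addl i n).
  rewrite addnK !natrM => <-; field.
  by rewrite !fact_neq0 expf_neq0 ?andbT ?(gt_eqF m0)// pnatr_eq0 -lt0n bin_gt0
    leq_addl.
under eq_integral do rewrite gamma_tail_mul ?gt_eqF// EFinD.
have mhalf d d' i j : measurable_fun (`[0%R, +oo[%classic : set R) (fun r : R =>
    \sum_(0 <= n < j.+1) 'C(i + n, n)%:R * d ^+ i.+1 * d' ^+ n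
      / (c + c') ^+ (i + n).+1 * gamma_tail (c + c') (i + n) (expR r - 1)).
  apply: measurable_sum => n; apply: measurable_funM => //.
  exact: measurable_gamma_tail_expRB1.
have half_ge0 d d' i j r : 0 < d -> 0 < d' -> 0 <= r ->
    0 <= \sum_(0 <= n < j.+1) 'C(i + n, n)%:R * d ^+ i.+1 * d' ^+ n
      / (c + c') ^+ (i + n).+1 * gamma_tail (c + c') (i + n) (expR r - 1).
  move=> d0 d'0 /expRB1_ge0 r0; rewrite sumr_ge0// => n _.
  by rewrite mulr_ge0 ?coef_ge0// gamma_tail_ge0 ?(ltW m0).
rewrite ge0_integralD//= ?half//.
- by move=> r; rewrite in_itv/= andbT => r0; rewrite lee_fin half_ge0.
- by apply/measurable_EFinP; exact: mhalf.
- by move=> r; rewrite in_itv/= andbT => r0; rewrite lee_fin half_ge0.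
- by apply/measurable_EFinP; exact: mhalf.
Qed.

Lemma measurable_max_tail_expRB1 c c' a b D :
  measurable_fun D (fun r : R => max_tail c c' a b (expR r - 1)).
Proof.
apply: measurable_funB; last by
  apply: measurable_funM; exact: measurable_gamma_tail_expRB1.
by apply: measurable_funD; exact: measurable_gamma_tail_expRB1.
Qed.

Lemma integral_max_tail c c' a b : 0 < c -> 0 < c' ->
  (\int[mu]_(r in `[0%R, +oo[) (max_tail c c' a b (expR r - 1))%:E =
   (max_integral c c' a b)%:E)%E.
Proof.
move=> c0 c'0.
pose I := (\int[mu]_(r in `[0%R, +oo[) (max_tail c c' a b (expR r - 1))%:E)%E.
have tail_ge0 d k : 0 < d -> forall r, `[0%R, +oo[%classic r ->
    (0 <= (gamma_tail d k (expR r - 1))%:E)%E.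
  move=> d0 r; rewrite /= in_itv/= andbT => /expRB1_ge0 r0.
  by rewrite lee_fin gamma_tail_ge0 ?(ltW d0).
have mtail d k : measurable_fun (`[0%R, +oo[%classic : set R)
    (fun r : R => (gamma_tail d k (expR r - 1))%:E).
  by apply/measurable_EFinP; exact: measurable_gamma_tail_expRB1.
(* Additivity is available for nonnegative integrands, so the product of tails is added on the left
   and its finite integral subtracted afterwards. *)
have : (I + \int[mu]_(r in `[0%R, +oo[)
     (gamma_tail c a (expR r - 1) * gamma_tail c' b (expR r - 1))%:E =
     (tail_integral c a + tail_integral c' b)%:E)%E.
  rewrite -ge0_integralD//=.
  - rewrite EFinD -!integral_gamma_tail// -ge0_integralD//;
      [|exact: (tail_ge0 _ _ c0)|exact: mtail|exact: (tail_ge0 _ _ c'0)|exact: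
        mtail].
    by apply: eq_integral => r _; rewrite -!EFinD /max_tail subrK.
  - move=> r; rewrite /= in_itv/= andbT => /expRB1_ge0 r0.
    by rewrite lee_fin max_tail_ge0.
  - by apply/measurable_EFinP; exact: measurable_max_tail_expRB1.
  - by move=> r r0; rewrite EFinM mule_ge0 ?tail_ge0.
  - apply/measurable_EFinP; apply: measurable_funM;
      exact: measurable_gamma_tail_expRB1.
rewrite integral_gamma_tail_mul// -/I /max_integral.
set s := (_ + _ in X in (I + X)%E) => IE.
have := congr1 (fun z => z - s%:E)%E IE.
by rewrite addeK// => ->; rewrite -EFinB /s opprD addrA.
Qed.

Lemma max_integral_ge0 c c' a b : 0 < c -> 0 < c' -> 0 <= max_integral c c' a b.
Proof.
move=> c0 c'0; rewrite -lee_fin -integral_max_tail//; apply: integral_ge0 => r /=.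
by rewrite in_itv/= andbT => /expRB1_ge0 r0; rewrite lee_fin max_tail_ge0.
Qed.

Lemma max_integral_le c c' a b : 0 < c -> 0 < c' ->
  max_integral c c' a b <= tail_integral c a + tail_integral c' b.
Proof.
move=> c0 c'0; rewrite /max_integral -addrA gerDl -opprD oppr_le0.
rewrite -lee_fin -integral_gamma_tail_mul//; apply: integral_ge0 => r /=.
rewrite in_itv/= andbT => /expRB1_ge0 r0.
by rewrite lee_fin mulr_ge0 ?gamma_tail_ge0 ?(ltW c0) ?(ltW c'0).
Qed.

End GammaTail.

(** * Passage between real series and extended-real sums *)

Section RealSeries.
Variable R : realType.
Implicit Types (u p f : nat -> R) (l a b : R).

Lemma nneseries_EFin u : cvgn (series u) ->
  (\sum_(n <oo) (u n)%:E = (limn (series u))%:E)%E.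
Proof.
move=> cu; rewrite -EFin_lim//; congr (limn _); apply/funext => n.
by rewrite /series /= sumEFin.
Qed.

Lemma cvg_series_EFin u l : series u @ \oo --> l ->
  (\sum_(n <oo) (u n)%:E = l%:E)%E.
Proof.
move=> ul; rewrite nneseries_EFin; last by apply/cvg_ex; exists l.
by congr EFin; exact: cvg_lim ul.
Qed.

Lemma nneseries_cvg_series u l : (forall n, 0 <= u n) ->
  (\sum_(n <oo) (u n)%:E = l%:E)%E -> series u @ \oo --> l.
Proof.
move=> u0 ul; have cu : cvgn (series u).
  by apply: nnseries_is_cvg => //; rewrite ul ltry.
by move: ul; rewrite nneseries_EFin// => -[<-].
Qed.

Lemma cvg_series_affine p f s l a b :
  series p @ \oo --> s -> series (fun n => p n * f n) @ \oo --> l ->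
  series (fun n => p n * (a + b * f n)) @ \oo --> a * s + b * l.
Proof.
move=> ps fl.
have -> : series (fun n => p n * (a + b * f n)) =
    (fun n => a * series p n + b * series (fun n => p n * f n) n).
  apply/funext => n; rewrite /series /= !mulr_sumr -big_split /=.
  by apply: eq_bigr => i _; ring.
by apply: cvgD; apply: cvgMl_tmp.
Qed.

Lemma cvg_seriesZ p l a : series p @ \oo --> l ->
  series (fun n => a * p n) @ \oo --> a * l.
Proof.
move=> pl; have -> : series (fun n => a * p n) = (fun n => a * series p n).
  by apply/funext => n; rewrite /series /= mulr_sumr.
exact: cvgMl_tmp.
Qed.

End RealSeries.

(** * Layer cake formulas for logarithms *)

Section TailExpectation.
Context d (T : measurableType d) (R : realType) (P : probability T R).
Notation mu := (@lebesgue_measure R).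

Lemma expectation_tail (f : T -> R) : measurable_fun setT f ->
  (forall w, 0 <= f w) ->
  ('E_P[f] = \int[mu]_(r in `[0%R, +oo[) P (f @^-1` `]r, +oo[))%E.
Proof.
move=> mf f0.
have fP : isMeasurableFun _ _ T R f by constructor.
pose X : {RV P >-> R} := HB.pack f fP.
exact: (@ge0_expectation_ccdf _ _ _ P X).
Qed.

Lemma ln1D_gtE (x r : R) : 0 <= x -> (r < ln (1 + x)) = (expR r - 1 < x).
Proof.
move=> x0; have x1 : 0 < 1 + x by rewrite ltr_wpDr.
by rewrite -ltr_expR lnK ?posrE// ltrBlDl.
Qed.

(** The substitution takes place in the event, since ln (1 + x) > r iff x > exp(r) - 1; the measure
    dr stays unchanged. *)
Lemma expectation_ln1D (X : {RV P >-> R}) : (forall w, 0 <= X w) ->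
  ('E_P[fun w => ln (1 + X w)] =
   \int[mu]_(r in `[0%R, +oo[) P (X @^-1` `](expR r - 1)%R, +oo[))%E.
Proof.
move=> X0; rewrite expectation_tail.
- apply: eq_integral => r _; congr (P _); apply/seteqP; split => w /=;
  by rewrite !in_itv/= !andbT ln1D_gtE.
- apply: measurableT_comp; first exact: measurable_ln.
  by apply: measurable_funD.
- by move=> w; rewrite ln_ge0// lerDl.
Qed.

Lemma expectation_max_ln1D (X Y : {RV P >-> R}) :
  (forall w, 0 <= X w) -> (forall w, 0 <= Y w) -> independent_RVs X Y ->
  ('E_P[fun w => Num.max (ln (1 + X w)) (ln (1 + Y w))] =
   \int[mu]_(r in `[0%R, +oo[)
     (P (X @^-1` `](expR r - 1)%R, +oo[) + P (Y @^-1` `](expR r - 1)%R, +oo[)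
     - P (X @^-1` `](expR r - 1)%R, +oo[) * P (Y @^-1` `](expR r - 1)%R, +oo[)))%E.
Proof.
move=> X0 Y0 XY.
have mln (Z : {RV P >-> R}) : measurable_fun setT (fun w => ln (1 + Z w)).
  apply: measurableT_comp; first exact: measurable_ln.
  by apply: measurable_funD.
rewrite expectation_tail.
- apply: eq_integral => r _.
  (* Independence turns the product into the probability of the intersection; inclusion-exclusion
     then gives the union, which is the event for the maximum. *)
  rewrite -XY// -measureUfinl ?ltey_eq ?fin_num_measure//;
    [|exact: measurable_funPTI..].
  congr (P _); apply/seteqP; split => w /=;
    rewrite !in_itv/= !andbT lt_max !ln1D_gtE//.
    by move/orP.
  by move=> H; apply/orP.
- exact: measurable_maxr.
- by move=> w; rewrite le_max ln_ge0// lerDl.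
Qed.

End TailExpectation.

(** * Mixtures of gamma laws with integer shapes *)

Section GammaMixture.
Context d (T : measurableType d) (R : realType) (P : probability T R).
Notation mu := (@lebesgue_measure R).
Implicit Types (X Y : {RV P >-> R}) (c : R) (p : nat -> R).

(** A mixture is recorded through its tails, all that the layer cake formula sees; [p j] is the
    weight of shape j + 1. *)
Record gamma_mixture X c p : Prop := GammaMixture {
  mixture_rate : 0 < c;
  mixture_weight_ge0 : forall j, 0 <= p j;
  mixture_weight_sum : series p @ \oo --> (1 : R);
  mixture_tail : forall t, 0 <= t ->
    P (X @^-1` `]t, +oo[) = (\sum_(j <oo) (p j * gamma_tail c j t)%:E)%E }.

Lemma mixture_tail_cvg X c p t : gamma_mixture X c p -> 0 <= t ->
  exists2 F : R, P (X @^-1` `]t, +oo[) = F%:E &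
    series (fun j => p j * gamma_tail c j t) @ \oo --> F.
Proof.
move=> [c0 p0 p1 pt] t0; exists (fine (P (X @^-1` `]t, +oo[))).
  by rewrite fineK// fin_num_measure//; exact: measurable_funPTI.
apply: nneseries_cvg_series.
  by move=> j; rewrite mulr_ge0 ?gamma_tail_ge0 ?(ltW c0).
by rewrite -pt// fineK// fin_num_measure//; exact: measurable_funPTI.
Qed.

(** Integrating the density series term by term over []t, +oo[] gives the tails. Measurability of
    [f] comes from its being a sum of nonnegative measurable functions there. *)
Lemma mixture_density X c p (f : R -> R) : 0 < c -> (forall j, 0 <= p j) ->
  (forall x, 0 <= x -> series (fun j => p j * gamma_pdf c j x) @ \oo --> f x) ->
  (forall A : set R, measurable A -> distribution P X A =
     (\int[mu]_(x in A `&` `]0%R, +oo[) (f x)%:E)%E) ->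
  gamma_mixture X c p.
Proof.
move=> c0 p0 pf XA.
have fE x : 0 <= x -> (f x)%:E = (\sum_(j <oo) (p j * gamma_pdf c j x)%:E)%E.
  by move=> x0; rewrite (cvg_series_EFin (pf x x0)).
have intE t : 0 <= t -> (\int[mu]_(x in `]t, +oo[) (f x)%:E =
    \sum_(j <oo) (p j * gamma_tail c j t)%:E)%E.
  move=> t0; rewrite integral_itv_obnd_cbnd; last first.
    apply: (@eq_measurable_fun _ _ _ _ _ (fun x =>
      \sum_(j <oo) (p j * gamma_pdf c j x)%:E)%E).
      by move=> x; rewrite inE/= in_itv/= andbT => /ltW/(le_trans t0) /fE ->.
    apply: ge0_emeasurable_sum => [j x|j _].
      rewrite /= in_itv/= andbT => /ltW/(le_trans t0) x0 _.
      by rewrite lee_fin mulr_ge0 ?gamma_pdf_ge0 ?(ltW c0).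
    apply/measurable_EFinP; apply: measurable_funM => //.
    exact: measurable_poly_exp.
  transitivity (\int[mu]_(x in `[t, +oo[)
      (\sum_(j <oo) (p j * gamma_pdf c j x)%:E))%E.
    apply: eq_integral => x; rewrite inE/= in_itv/= andbT => tx.
    by rewrite fE// (le_trans t0).
  rewrite integral_nneseries//; last 2 first.
  - move=> j; apply/measurable_EFinP; apply: measurable_funM => //.
    exact: measurable_poly_exp.
  - move=> j x; rewrite /= in_itv/= andbT => /(le_trans t0) x0.
    by rewrite lee_fin mulr_ge0 ?gamma_pdf_ge0 ?(ltW c0).
  apply: eq_eseriesr => j _.
  under eq_integral do rewrite EFinM.
  rewrite ge0_integralZl_EFin//.
  - by rewrite integral_gamma_pdf.
  - move=> x; rewrite /= in_itv/= andbT => /(le_trans t0) x0.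
    by rewrite lee_fin gamma_pdf_ge0 ?(ltW c0).
  - by apply/measurable_EFinP; exact: measurable_poly_exp.
split=> //.
(* The total mass 1 lies on []0, +oo[], and every gamma tail equals 1 at 0; hence the weights sum to
   1. *)
- apply: nneseries_cvg_series => //.
  have := XA setT measurableT; rewrite probability_setT setTI intE// => ->.
  by apply: eq_eseriesr => j _; rewrite gamma_tail_at0 mulr1.
- move=> t t0; rewrite -intE//.
  have := XA `]t, +oo[%classic; rewrite /distribution /pushforward => -> //.
  rewrite setIidl// => x /=; rewrite !in_itv/= !andbT; exact: le_lt_trans.
Qed.

Lemma expectation_ln1D_mixture X c p : (forall w, 0 <= X w) ->
  gamma_mixture X c p ->
  ('E_P[fun w => ln (1 + X w)] = \sum_(j <oo) (p j * tail_integral c j)%:E)%E.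
Proof.
move=> X0 [c0 p0 p1 pt]; rewrite expectation_ln1D//.
transitivity (\int[mu]_(r in `[0%R, +oo[)
    (\sum_(j <oo) (p j * gamma_tail c j (expR r - 1))%:E))%E.
  apply: eq_integral => r; rewrite inE/= in_itv/= andbT => /expRB1_ge0 r0.
  exact: pt.
rewrite integral_nneseries//; last 2 first.
- move=> j; apply/measurable_EFinP; apply: measurable_funM => //.
  exact: measurable_gamma_tail_expRB1.
- move=> j r; rewrite /= in_itv/= andbT => /expRB1_ge0 r0.
  by rewrite lee_fin mulr_ge0 ?gamma_tail_ge0 ?(ltW c0).
apply: eq_eseriesr => j _.
under eq_integral do rewrite EFinM.
rewrite ge0_integralZl_EFin//.
- by rewrite integral_gamma_tail.
- move=> r; rewrite /= in_itv/= andbT => /expRB1_ge0 r0.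
  by rewrite lee_fin gamma_tail_ge0 ?(ltW c0).
- by apply/measurable_EFinP; exact: measurable_gamma_tail_expRB1.
Qed.

Lemma expectation_max_ln1D_mixture X Y c c' p q :
  (forall w, 0 <= X w) -> (forall w, 0 <= Y w) -> independent_RVs X Y ->
  gamma_mixture X c p -> gamma_mixture Y c' q ->
  ('E_P[fun w => Num.max (ln (1 + X w)) (ln (1 + Y w))] =
   \sum_(a <oo) \sum_(b <oo) (p a * q b * max_integral c c' a b)%:E)%E.
Proof.
move=> X0 Y0 XY mX mY; rewrite expectation_max_ln1D//.
have [c0 p0 p1 _] := mX; have [c'0 q0 q1 _] := mY.
have ge0 a b r : `[0%R, +oo[%classic r ->
    (0 <= (p a * q b * max_tail c c' a b (expR r - 1))%:E)%E.
  rewrite /= in_itv/= andbT => /expRB1_ge0 r0.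
  by rewrite lee_fin !mulr_ge0 ?max_tail_ge0.
have meas a b : measurable_fun (`[0%R, +oo[%classic : set R)
    (fun r : R => (p a * q b * max_tail c c' a b (expR r - 1))%:E).
  apply/measurable_EFinP; apply: measurable_funM => //.
  exact: measurable_max_tail_expRB1.
transitivity (\int[mu]_(r in `[0%R, +oo[) (\sum_(a <oo) \sum_(b <oo)
    (p a * q b * max_tail c c' a b (expR r - 1))%:E))%E.
  apply: eq_integral => r; rewrite inE/= in_itv/= andbT => /expRB1_ge0 r0.
  have [F -> pF] := mixture_tail_cvg mX r0.
  have [G -> qG] := mixture_tail_cvg mY r0.
  set x := expR r - 1 in pF qG *.
  rewrite -EFinM -EFinN -!EFinD; apply/esym.
  (* The inner sum over [b] comes first: as the weights sum to 1, the affine form becomes Q_a + (1 -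
     Q_a) G = G + (1 - G) Q_a, affine in Q_a again, and the sum over [a] yields F + G - F G. *)
  transitivity (\sum_(a <oo) (p a * (G + (1 - G) * gamma_tail c a x))%:E)%E.
    apply: eq_eseriesr => a _; apply: cvg_series_EFin.
    have -> : (fun b => p a * q b * max_tail c c' a b x) = (fun b => p a *
        (q b * (gamma_tail c a x + (1 - gamma_tail c a x) * gamma_tail c' b x))).
      by apply/funext => b; rewrite max_tailE mulrA.
    rewrite [G + _](_ : _ = gamma_tail c a x * 1 + (1 - gamma_tail c a x) * G);
      last by ring.
    by apply: cvg_seriesZ; exact: cvg_series_affine.
  apply: cvg_series_EFin.
  rewrite [F + _ - _](_ : _ = G * 1 + (1 - G) * F); last by ring.
  exact: cvg_series_affine.
rewrite integral_nneseries//; last 2 first.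
- move=> a; apply: ge0_emeasurable_sum => [b r r0 _|b _]; first exact: ge0.
  exact: meas.
- by move=> a r r0; apply: nneseries_ge0 => b _ _; exact: ge0.
apply: eq_eseriesr => a _.
rewrite integral_nneseries//; [|exact: meas|by move=> b r; exact: ge0].
apply: eq_eseriesr => b _.
under eq_integral do rewrite EFinM.
rewrite ge0_integralZl_EFin//.
- by rewrite integral_max_tail.
- move=> r; rewrite /= in_itv/= andbT => /expRB1_ge0 r0.
  by rewrite lee_fin max_tail_ge0.
- by apply/measurable_EFinP; exact: measurable_max_tail_expRB1.
- exact: mulr_ge0.
Qed.

End GammaMixture.

(** * Geometric control of the fading coefficients *)

Section FTRWeights.
Variable R : realType.
Notation mu := (@lebesgue_measure R).
Variables (m K Delta : R).
Hypotheses (m_gt0 : 0 < m) (K_ge0 : 0 <= K) (Delta01 : 0 <= Delta <= 1).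

(** The mixture weight without the prefactor m^m / Gamma(m); the other j! of the density belongs to
    [gamma_pdf]. *)
Definition ftr_weight (j : nat) : R := K ^+ j * ftr_d m K Delta j / j`!%:R.

Lemma Gamma_ge0 (a : R) : 0 <= Gamma a.
Proof. by apply: Rintegral_ge0 => t _; rewrite mulr_ge0 ?powR_ge0 ?expR_ge0. Qed.

Lemma cos_amplitude_ge0 (theta : R) : 0 <= 1 + Delta * cos theta.
Proof.
have /andP[D0 D1] := Delta01.
have c1 := cos_geN1 theta.
have : Delta * -1 <= Delta * cos theta by apply: ler_wpM2l.
lra.
Qed.

Lemma cos_amplitude_le2 (theta : R) : 1 + Delta * cos theta <= 2.
Proof.
have /andP[D0 D1] := Delta01.
have c1 := cos_le1 theta.
have : Delta * cos theta <= Delta * 1 by apply: ler_wpM2l.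
lra.
Qed.

Lemma ftr_d_ge0 j : 0 <= ftr_d m K Delta j.
Proof.
rewrite mulr_ge0 ?divr_ge0 ?Gamma_ge0 ?pi_ge0//.
apply: Rintegral_ge0 => t _.
by rewrite divr_ge0 ?powR_ge0// exprn_ge0 ?cos_amplitude_ge0.
Qed.

Lemma ftr_weight_ge0 j : 0 <= ftr_weight j.
Proof. by rewrite divr_ge0// mulr_ge0 ?ftr_d_ge0// exprn_ge0. Qed.

(** The largest value of K v / (m + K v) for v in [0, 2], the range allowed to v = 1 + Delta
    cos(theta). *)
Definition ftr_ratio := 2 * K / (m + 2 * K).
Local Notation q := ftr_ratio.

Lemma ftr_ratio_den_gt0 : 0 < m + 2 * K.
Proof. have := m_gt0; have := K_ge0; lra. Qed.

Lemma ftr_ratio_ge0 : 0 <= q.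
Proof. by rewrite /ftr_ratio divr_ge0 ?mulr_ge0// (ltW ftr_ratio_den_gt0). Qed.

Lemma ftr_ratio_lt1 : q < 1.
Proof.
rewrite /ftr_ratio ltr_pdivrMr ?ftr_ratio_den_gt0// mul1r.
by rewrite ltrDr.
Qed.

(** With v as above, the left side is (K v / (m + K v))^j (m + K v)^(- m), and the two factors are
    bounded separately. *)
Lemma ftr_integrand_le j theta :
  K ^+ j * ((1 + Delta * cos theta) ^+ j /
     (m + K + K * Delta * cos theta) `^ (j%:R + m)) <= q ^+ j * m `^ (- m).
Proof.
set v := 1 + Delta * cos theta.
have v0 : 0 <= v := cos_amplitude_ge0 theta.
have v2 : v <= 2 := cos_amplitude_le2 theta.
have Kv0 : 0 <= K * v by rewrite mulr_ge0.
have -> : m + K + K * Delta * cos theta = m + K * v by rewrite /v; ring.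
have D0 : 0 < m + K * v by rewrite ltr_wpDr.
rewrite powRD; last by rewrite (gt_eqF D0) implybT.
rewrite powR_mulrn ?(ltW D0)// mulrA -exprMn invfM mulrA -exprVn -exprMn powRN.
apply: ler_pM; rewrite ?exprn_ge0 ?invr_ge0 ?powR_ge0 ?divr_ge0 ?(ltW D0)//.
  rewrite lerXn2r ?nnegrE ?ftr_ratio_ge0 ?divr_ge0 ?(ltW D0)//.
  rewrite ler_pdivrMr// /ftr_ratio mulrAC ler_pdivlMr;
    last exact: ftr_ratio_den_gt0.
  have : K * v * m <= K * 2 * m by rewrite ler_wpM2r ?(ltW m_gt0)// ler_wpM2l.
  nra.
rewrite lef_pV2 ?posrE ?powR_gt0//.
by rewrite ge0_ler_powR ?nnegrE ?(ltW m_gt0) ?(ltW D0)// lerDl.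
Qed.

Lemma ftr_d_le j : K ^+ j * ftr_d m K Delta j <= Gamma (j%:R + m) * m `^ (- m)
  * q ^+ j.
Proof.
pose h theta := (1 + Delta * cos theta) ^+ j /
  (m + K + K * Delta * cos theta) `^ (j%:R + m).
pose I := (\int[mu]_(t in `[0%R, pi]) (h t)%:E)%E.
rewrite /ftr_d /Rintegral -/I.
have h0 t : 0 <= h t.
  by rewrite divr_ge0 ?powR_ge0// exprn_ge0 ?cos_amplitude_ge0.
have mh : measurable_fun (`[0, pi]%classic : set R) h.
  have -> : h = fun t => (1 + Delta * cos t) ^+ j *
      (m + K + K * Delta * cos t) `^ (- (j%:R + m)).
    by apply/funext => t; rewrite powRN.
  have mc (a b : R) : measurable_fun (`[0, pi]%classic : set R) (fun t =>
    a + b * cos t).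
    apply: measurable_funTS; apply: measurable_funD => //;
      apply: measurable_funM => //.
    by apply: continuous_measurable_fun; exact: continuous_cos.
  apply: measurable_funM; first by apply: measurable_funX; exact: mc.
  apply: (@measurableT_comp _ _ _ _ _ _ (@powR R ^~ (- (j%:R + m))));
    first exact: measurable_powR.
  exact: mc.
have KI : ((K ^+ j)%:E * I <= (pi * (q ^+ j * m `^ (- m)))%:E)%E.
  rewrite -ge0_integralZl_EFin//=; last 3 first.
  - by move=> t _; rewrite lee_fin.
  - exact/measurable_EFinP.
  - exact: exprn_ge0.
  apply: (@le_trans _ _ (\int[mu]_(t in `[0%R, pi]) (q ^+ j * m `^ (- m))%:E)%E).
    apply: ge0_le_integral => //=.
    - by move=> t _; rewrite -EFinM lee_fin mulr_ge0 ?exprn_ge0.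
    - by apply/measurable_EFinP; apply: measurable_funM.
    - by move=> t _; rewrite -EFinM lee_fin ftr_integrand_le.
  by rewrite integral_cst//= lebesgue_measure_itv/= lte_fin pi_gt0 -EFinB subr0
    -EFinM mulrC.
have I0 : (0 <= I)%E by apply: integral_ge0 => t _; rewrite lee_fin.
have fineI : K ^+ j * fine I <= pi * (q ^+ j * m `^ (- m)).
  move: I I0 KI => [r| |]//=.
  (* If the integral is +oo, its real part is 0 and the bound is trivial. *)
  by rewrite mulr0 => _ _; rewrite !mulr_ge0 ?pi_ge0 ?exprn_ge0 ?powR_ge0
    ?ftr_ratio_ge0.
have -> : Gamma (j%:R + m) * m `^ (- m) * q ^+ j =
    Gamma (j%:R + m) / pi * (pi * (q ^+ j * m `^ (- m))).
  by rewrite mulrA divfK ?gt_eqF ?pi_gt0// -mulrA [X in _ * X]mulrC.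
by rewrite mulrCA ler_wpM2l ?divr_ge0 ?Gamma_ge0 ?pi_ge0.
Qed.

End FTRWeights.

(** * The series of gamma values against a geometric sequence *)

Section GammaSeries.
Variable R : realType.
Notation mu := (@lebesgue_measure R).
Implicit Types (a m q c : R).

(* If the integral diverged, [Gamma a] would be [fine +oo = 0]. *)
Lemma Gamma_le_integral a :
  ((Gamma a)%:E <= \int[mu]_(t in `]0%R, +oo[) (t `^ (a - 1) * expR (- t))%:E)%E.
Proof.
rewrite /Gamma /upper_Gamma /Rintegral; set I := (\int[mu]_(t in _) _)%E.
have : (0 <= I)%E.
  by apply: integral_ge0 => t _; rewrite lee_fin mulr_ge0 ?powR_ge0 ?expR_ge0.
by move: I => [r| |]//= _; rewrite leey.
Qed.

(** Summing under the integral, the sum of (q t)^j / j! is at most exp(q t), which leaves t^m exp(-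
    (1 - q) t). Replacing t^m by 1 + t^N with an integer N >= m makes the bound explicit. *)
Lemma Gamma_series_bounded m q : 0 < m -> 0 <= q -> q < 1 ->
  exists M : R, forall n,
    \sum_(j < n) Gamma (j.+1%:R + m) * (q ^+ j / j`!%:R) <= M.
Proof.
move=> m0 q0 q1; pose c := 1 - q; have c0 : 0 < c by rewrite subr_gt0.
pose N := Num.bound m.
have mN : m <= N%:R := ltW (archi_boundP (ltW m0)).
(* The majorant is a combination of gamma densities, so its integral is the sum of its
   coefficients. *)
pose g t := c^-1 * gamma_pdf c 0 t + N`!%:R / c ^+ N.+1 * gamma_pdf c N t.
have gE t : g t = (1 + t ^+ N) * expR (- (c * t)).
  rewrite /g !gamma_pdfE !exprMn !expr0 fact0 exprS; field.
  by rewrite fact_neq0 expf_neq0 gt_eqF.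
exists (c^-1 + N`!%:R / c ^+ N.+1) => -[|n].
  by rewrite big_ord0 addr_ge0 ?divr_ge0 ?invr_ge0 ?exprn_ge0 ?(ltW c0).
have mG a : measurable_fun (`]0%R, +oo[%classic : set R)
    (fun t : R => (t `^ (a - 1) * expR (- t))%:E).
  apply/measurable_EFinP; apply: measurable_funM.
    exact: measurable_funTS (measurable_powR _).
  by apply: measurableT_comp => //; exact: measurable_expR.
have Gge0 a t : (0 <= (t `^ (a - 1) * expR (- t))%:E)%E.
  by rewrite lee_fin mulr_ge0 ?powR_ge0 ?expR_ge0.
have coef_ge0 j : 0 <= q ^+ j / j`!%:R by rewrite divr_ge0 ?exprn_ge0.
have mg : measurable_fun setT g.
  apply: measurable_funD; apply: measurable_funM => //; exact: measurable_poly_exp.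
have int_g : (\int[mu]_(t in `[0%R, +oo[) (g t)%:E =
    (c^-1 + N`!%:R / c ^+ N.+1)%:E)%E.
  under eq_integral do rewrite EFinD !EFinM.
  rewrite ge0_integralD//=; last 4 first.
  - move=> t; rewrite in_itv/= andbT => t0.
    by rewrite -EFinM lee_fin mulr_ge0 ?invr_ge0 ?gamma_pdf_ge0 ?(ltW c0).
  - apply/measurable_EFinP; apply: measurable_funM => //;
      exact: measurable_poly_exp.
  - move=> t; rewrite in_itv/= andbT => t0.
    by rewrite -EFinM lee_fin mulr_ge0 ?divr_ge0 ?exprn_ge0 ?gamma_pdf_ge0
      ?(ltW c0).
  - apply/measurable_EFinP; apply: measurable_funM => //;
      exact: measurable_poly_exp.
  have int_pdf k (d : R) : 0 <= d ->
      (\int[mu]_(t in `[0%R, +oo[) (d%:E * (gamma_pdf c k t)%:E) = d%:E)%E.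
    move=> d0; rewrite ge0_integralZl_EFin//.
    - by rewrite integral_gamma_pdf// gamma_tail_at0 mule1.
    - move=> t; rewrite /= in_itv/= andbT => t0.
      by rewrite lee_fin gamma_pdf_ge0 ?(ltW c0).
    - by apply/measurable_EFinP; exact: measurable_poly_exp.
  by rewrite !int_pdf// ?divr_ge0 ?invr_ge0 ?exprn_ge0 ?(ltW c0).
have int_g_open : (\int[mu]_(t in `]0%R, +oo[) (g t)%:E =
    (c^-1 + N`!%:R / c ^+ N.+1)%:E)%E.
  rewrite integral_itv_obnd_cbnd//.
  by apply/measurable_EFinP; exact: measurable_funTS.
rewrite -lee_fin -int_g_open -sumEFin.
apply: (@le_trans _ _ (\int[mu]_(t in `]0%R, +oo[) \sum_(j < n.+1)
    ((q ^+ j / j`!%:R)%:E * (t `^ (j.+1%:R + m - 1) * expR (- t))%:E))%E).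
  rewrite ge0_integral_sum//; last 2 first.
  - move=> j; apply: measurable_funeM; exact: mG.
  - by move=> j t _; apply: mule_ge0; [rewrite lee_fin|].
  apply: lee_sum => j _; rewrite ge0_integralZl_EFin//; last exact: mG.
  rewrite mulrC EFinM; apply: lee_wpmul2l; first by rewrite lee_fin.
  exact: Gamma_le_integral.
apply: ge0_le_integral => //=.
- by move=> t _; apply: sume_ge0 => j _; apply: mule_ge0; [rewrite lee_fin|].
- apply: emeasurable_sum => j; apply: measurable_funeM; exact: mG.
- by apply/measurable_EFinP; exact: measurable_funTS.
move=> t; rewrite in_itv/= andbT => t0; rewrite sumEFin lee_fin.
(* Splitting exp(- t) = exp(- q t) exp(- c t) turns the partial sum into a gamma tail at q t, hence
   at most 1. *)
have -> : \sum_(j < n.+1) q ^+ j / j`!%:R * (t `^ (j.+1%:R + m - 1) * expR (- t)) =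
    gamma_tail 1 n (q * t) * (t `^ m * expR (- (c * t))).
  rewrite /gamma_tail /poly_exp horner_texp !mulr_suml; apply: eq_bigr => j _.
  have -> : j.+1%:R + m - 1 = j%:R + m by rewrite -natr1; ring.
  rewrite powRD ?(gt_eqF t0) ?implybT// powR_mulrn ?(ltW t0)//.
  have -> : - t = - (1 * (q * t)) + - (c * t) by rewrite /c; ring.
  by rewrite expRD !mul1r !exprMn; ring.
rewrite gE; apply: (@le_trans _ _ (1 * (t `^ m * expR (- (c * t))))).
  apply: ler_wpM2r; first by rewrite mulr_ge0 ?powR_ge0 ?expR_ge0.
  by rewrite gamma_tail_le1// mulr_ge0 ?(ltW t0).
rewrite mul1r ler_wpM2r ?expR_ge0//.
have [t1|t1] := leP t 1.
  apply: (@le_trans _ _ 1); last by rewrite lerDl exprn_ge0 ?(ltW t0).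
  have := @ge0_ler_powR R m (ltW m0) t 1.
  by rewrite powR1 !nnegrE => ->//; exact: ltW.
apply: (@le_trans _ _ (t ^+ N)); last by rewrite lerDr.
by rewrite -powR_mulrn ?(ltW t0)// ler_powR// ltW.
Qed.

End GammaSeries.

(** * The fading law as a gamma mixture *)

Section FTRMixture.
Variable R : realType.
Notation mu := (@lebesgue_measure R).
Implicit Types (m K Delta s : R).

(** The factor j + 1 is the growth of [tail_integral] in its shape; this single series dominates all
    those of the theorem. *)
Lemma ftr_weight_summable m K Delta : 0 < m -> 0 <= K -> 0 <= Delta <= 1 ->
  cvgn (series (fun j => ftr_weight m K Delta j * j.+1%:R)).
Proof.
move=> m0 K0 D01; set u := fun j => _.
have u0 j : 0 <= u j by rewrite mulr_ge0 ?ftr_weight_ge0.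
have q0 := ftr_ratio_ge0 m0 K0; have q1 := ftr_ratio_lt1 m0 K0.
set q := ftr_ratio m K in q0 q1.
have [M HM] := Gamma_series_bounded m0 q0 q1.
(* The index shift absorbs the factor: (j + 2) / (j + 1)! <= 2 / j!, while q^(j+1) <= q^j. *)
have uS j : u j.+1 <= 2 * m `^ (- m) * (Gamma (j.+1%:R + m) * (q ^+ j / j`!%:R)).
  have dle := ftr_d_le m0 K0 D01 j.+1.
  rewrite /u /ftr_weight factSr invfM.
  apply: (@le_trans _ _ (Gamma (j.+1%:R + m) * m `^ (- m) * q ^+ j.+1 / j`!%:R *
     (j.+2%:R / j.+1%:R))).
    rewrite [X in X <= _](_ : _ = K ^+ j.+1 * ftr_d m K Delta j.+1 / j`!%:R *
      (j.+2%:R / j.+1%:R)); last by ring.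
    by rewrite !ler_wpM2r// invr_ge0.
  rewrite [X in _ <= X](_ : _ = Gamma (j.+1%:R + m) * m `^ (- m) * q ^+ j /
    j`!%:R * 2);
    last by ring.
  apply: ler_pM.
  - by rewrite !mulr_ge0 ?invr_ge0 ?Gamma_ge0 ?powR_ge0 ?exprn_ge0.
  - by rewrite divr_ge0.
  - rewrite ler_wpM2r ?invr_ge0// ler_wpM2l ?mulr_ge0 ?Gamma_ge0 ?powR_ge0//.
    by rewrite exprS ler_piMl ?exprn_ge0 ?(ltW q1).
  - by rewrite ler_pdivrMr ?ltr0n// -natrM ler_nat mul2n -addnn addSn ltnS leq_addl.
apply: nondecreasing_is_cvgn; first exact: nondecreasing_series.
exists (u 0 + 2 * m `^ (- m) * M) => _ [n _ <-].
case: n => [|n].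
  rewrite /series /= big_geq//; apply: addr_ge0; first exact: u0.
  have M0 : 0 <= M by have := HM 0%N; rewrite big_ord0.
  by rewrite !mulr_ge0 ?powR_ge0.
rewrite /series /= big_mkord big_ord_recl lerD2l.
apply: (le_trans (ler_sum _ (fun (i : 'I_n) _ => uS i))).
by rewrite -mulr_sumr ler_wpM2l ?mulr_ge0 ?powR_ge0// HM.
Qed.

(** [ftr_pdf] is defined by [limn], so the content is convergence, by comparison with the weights
    times the uniform bound on the gamma densities. *)
Lemma ftr_pdf_series m K Delta s x :
  0 < m -> 0 <= K -> 0 <= Delta <= 1 -> 0 < s -> 0 <= x ->
  series (fun j => m `^ m / Gamma m * ftr_weight m K Delta j *
     gamma_pdf (2 * s)^-1 j x) @ \oo --> ftr_pdf m K Delta s x.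
Proof.
move=> m0 K0 D01 s0 x0.
have c0 : 0 < (2 * s)^-1 by rewrite invr_gt0 mulr_gt0.
rewrite /ftr_pdf.
have -> : (fun j => m `^ m / Gamma m * ftr_weight m K Delta j * gamma_pdf (2 *
  s)^-1 j x) =
  (fun j => m `^ m / Gamma m * (ftr_weight m K Delta j * gamma_pdf (2 * s)^-1 j x)).
  by apply/funext => j; rewrite mulrA.
have -> : (fun j : nat => K ^+ j * ftr_d m K Delta j / (j`!%:R * j`!%:R) *
    (x ^+ j / (2 * s) ^+ j.+1) * expR (- (x / (2 * s)))) =
  (fun j => ftr_weight m K Delta j * gamma_pdf (2 * s)^-1 j x).
  apply/funext => j; rewrite /ftr_weight /gamma_pdf /poly_exp hornerZ hornerXn.
  by rewrite invfM exprVn [_^-1 * x]mulrC; ring.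
apply: cvg_seriesZ.
suff : cvgn (series (fun j =>
  ftr_weight m K Delta j * gamma_pdf (2 * s)^-1 j x)) by [].
apply: (@series_le_cvg _ _ (fun j =>
  (2 * s)^-1 * (ftr_weight m K Delta j * j.+1%:R))).
- move=> j; apply: mulr_ge0; first exact: ftr_weight_ge0.
  exact: gamma_pdf_ge0 (ltW c0) x0.
- move=> j; apply: mulr_ge0; first exact: ltW.
  by apply: mulr_ge0; first exact: ftr_weight_ge0.
- move=> j; rewrite /= [X in _ <= X]mulrCA ler_wpM2l ?ftr_weight_ge0//.
  apply: (le_trans (gamma_pdf_le _ (ltW c0) x0)).
  by rewrite ler_peMr ?(ltW c0)// ler1n.
- have /cvg_ex[l Hl] := ftr_weight_summable m0 K0 D01.
  by apply/cvg_ex; exists ((2 * s)^-1 * l); exact: cvg_seriesZ.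
Qed.

Lemma ftr_gamma_mixture d (T : measurableType d) (P : probability T R)
    (X : {RV P >-> R}) m K Delta s :
  0 < m -> 0 <= K -> 0 <= Delta <= 1 -> 0 < s ->
  is_ftr_snr X m K Delta s ->
  gamma_mixture X (2 * s)^-1 (fun j => m `^ m / Gamma m * ftr_weight m K Delta j).
Proof.
move=> m0 K0 D01 s0 HX; apply: (@mixture_density _ _ _ _ _ _ _ (ftr_pdf m K
  Delta s)) => //.
- by rewrite invr_gt0 mulr_gt0.
- by move=> j; rewrite mulr_ge0 ?ftr_weight_ge0// divr_ge0 ?powR_ge0 ?Gamma_ge0.
- by move=> x x0; exact: ftr_pdf_series.
Qed.

End FTRMixture.

(** * The terms of the secrecy formula and their summability *)

Section SecrecyTerms.
Variable R : realType.
Variables (mD KD DeltaD sD mE KE DeltaE sE : R).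
Hypotheses (hmD : 0 < mD) (hKD : 0 <= KD) (hDeltaD : 0 <= DeltaD <= 1) (hsD : 0
  < sD).
Hypotheses (hmE : 0 < mE) (hKE : 0 <= KE) (hDeltaE : 0 <= DeltaE <= 1) (hsE : 0
  < sE).

Let wD := ftr_weight mD KD DeltaD.
Let wE := ftr_weight mE KE DeltaE.
Let cD := (2 * sD)^-1.
Let cE := (2 * sE)^-1.
Let a := asc_term mD KD DeltaD sD mE KE DeltaE sE.
Let c := asc_corr_term mE KE DeltaE sE.

Let cD0 : 0 < cD. Proof. by rewrite invr_gt0 mulr_gt0. Qed.
Let cE0 : 0 < cE. Proof. by rewrite invr_gt0 mulr_gt0. Qed.

Lemma asc_corr_termE j : c j = wE j * tail_integral cE j.
Proof.
rewrite /c /asc_corr_term /wE /ftr_weight /tail_integral /cE exprVn !invfM; ring.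
Qed.

Lemma asc_termE i j : a i j = wD i * wE j * max_integral cD cE i j.
Proof.
have -> : a i j = wD i * wE j *
  (tail_integral cD i + tail_integral cE j
   - \sum_(0 <= n < j.+1)
       S_fun (i + n).+1 ((sD + sE) / (2 * sD * sE)) /
       (n`!%:R * i`!%:R * (2 * sE) ^+ n * (2 * sD) ^+ i.+1)
   - \sum_(0 <= n < i.+1)
       S_fun (j + n).+1 ((sD + sE) / (2 * sD * sE)) /
       (n`!%:R * j`!%:R * (2 * sD) ^+ n * (2 * sE) ^+ j.+1)).
  rewrite /a /asc_term /wD /wE /ftr_weight /tail_integral /cD /cE.
  by congr (_ * (_ + _ - _ - _)); rewrite ?exprVn ?invfM; ring.
have -> : (sD + sE) / (2 * sD * sE) = cD + cE.
  by rewrite /cD /cE; field; rewrite !gt_eqF.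
rewrite /max_integral; congr (_ * (_ - _ - _)); apply: eq_bigr => n _;
  by rewrite /cD /cE !exprVn !invfM; ring.
Qed.

Lemma asc_term_ge0 i j : 0 <= a i j.
Proof.
rewrite asc_termE; apply: mulr_ge0; last exact: max_integral_ge0.
by apply: mulr_ge0; exact: ftr_weight_ge0.
Qed.

Lemma asc_corr_term_ge0 j : 0 <= c j.
Proof.
rewrite asc_corr_termE; apply: mulr_ge0; first exact: ftr_weight_ge0.
exact: tail_integral_ge0.
Qed.

Lemma asc_corr_term_cvg : cvgn (series c).
Proof.
have /cvg_ex[l Hl] := ftr_weight_summable hmE hKE hDeltaE.
apply: (@series_le_cvg _ _ (fun j => cE^-1 * (wE j * j.+1%:R))).
- exact: asc_corr_term_ge0.
- move=> j; apply: mulr_ge0; first by rewrite invr_ge0 ltW.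
  by apply: mulr_ge0; first exact: ftr_weight_ge0.
- move=> j; rewrite asc_corr_termE /= [X in _ <= X]mulrCA.
  rewrite ler_wpM2l ?ftr_weight_ge0// mulrC; exact: tail_integral_le.
- by apply/cvg_ex; exists (cE^-1 * l); exact: cvg_seriesZ.
Qed.

(** From (i + 1) / cD + (j + 1) / cE <= (1 / cD + 1 / cE) (i + 1) (j + 1). The product form makes
    every row sum a multiple of one constant [W]. *)
Let bound i j := (cD^-1 + cE^-1) * (wD i * i.+1%:R) * (wE j * j.+1%:R).

Let asc_term_le i j : a i j <= bound i j.
Proof.
rewrite asc_termE /bound.
have -> : (cD^-1 + cE^-1) * (wD i * i.+1%:R) * (wE j * j.+1%:R) =
  wD i * wE j * (i.+1%:R / cD * j.+1%:R + j.+1%:R / cE * i.+1%:R) by ring.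
rewrite ler_wpM2l//; first by apply: mulr_ge0; exact: ftr_weight_ge0.
apply: (le_trans (max_integral_le _ _ cD0 cE0)).
have scale k l e : 0 < e -> tail_integral e k <= k.+1%:R / e * l.+1%:R.
  move=> e0; apply: (le_trans (tail_integral_le k e0)).
  by rewrite ler_peMr ?ler1n// divr_ge0 ?(ltW e0).
by apply: lerD; exact: scale.
Qed.

Let bound_ge0 i j : 0 <= bound i j.
Proof. exact: le_trans (asc_term_ge0 i j) (asc_term_le i j). Qed.

Let W := limn (series (fun j => wE j * j.+1%:R)).

Let bound_row i : series (bound i) @ \oo --> (cD^-1 + cE^-1) * (wD i * i.+1%:R) * W.
Proof. by apply: cvg_seriesZ; exact: (ftr_weight_summable hmE hKE hDeltaE). Qed.

Lemma asc_term_row_cvg i : cvgn (series (a i)).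
Proof.
apply: (@series_le_cvg _ _ (bound i)).
- exact: asc_term_ge0.
- exact: bound_ge0.
- exact: asc_term_le.
- by apply/cvg_ex; eexists; exact: bound_row.
Qed.

Lemma asc_term_cvg : cvgn (series (fun i => limn (series (a i)))).
Proof.
have row_ge0 i : 0 <= limn (series (a i)).
  rewrite -lee_fin -nneseries_EFin; last exact: asc_term_row_cvg.
  by apply: nneseries_ge0 => j _ _; rewrite lee_fin asc_term_ge0.
have row_le i : limn (series (a i)) <= (cD^-1 + cE^-1) * W * (wD i * i.+1%:R).
  have bc : cvgn (series (bound i)) by apply/cvg_ex; eexists; exact: bound_row.
  have rc : cvgn (series (a i)) by exact: asc_term_row_cvg.
  have := lim_series_le rc bc (asc_term_le i).
  have -> : limn (series (bound i)) = (cD^-1 + cE^-1) * (wD i * i.+1%:R) * W.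
    by apply: cvg_lim => //; exact: bound_row.
  by rewrite [X in _ <= X]mulrAC.
apply: (@series_le_cvg _ _ (fun i => (cD^-1 + cE^-1) * W * (wD i * i.+1%:R))) => //.
- by move=> i; exact: le_trans (row_ge0 i) (row_le i).
- have /cvg_ex[l Hl] := ftr_weight_summable hmD hKD hDeltaD.
  by apply/cvg_ex; eexists; apply: cvg_seriesZ; exact: Hl.
Qed.

End SecrecyTerms.

(** * The average secrecy capacity, with convergence of all the series involved *)

Theorem lemma1 (R : realType) (d : measure_display) (T : measurableType d)
    (P : probability T R) (gD gE : {RV P >-> R})
    (mD KD DeltaD sD mE KE DeltaE sE : R)
    (hmD : 0 < mD) (hKD : 0 <= KD) (hDeltaD : 0 <= DeltaD <= 1) (hsD : 0 < sD)
    (hmE : 0 < mE) (hKE : 0 <= KE) (hDeltaE : 0 <= DeltaE <= 1) (hsE : 0 < sE)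
    (hgD0 : forall w : T, 0 <= gD w) (hgE0 : forall w : T, 0 <= gE w)
    (hindep : independent_RVs gD gE)
    (hgD : is_ftr_snr gD mD KD DeltaD sD)
    (hgE : is_ftr_snr gE mE KE DeltaE sE) :
  let a := asc_term mD KD DeltaD sD mE KE DeltaE sE in
  let c := asc_corr_term mE KE DeltaE sE in
  [/\ forall jD : nat, cvgn (series (a jD)),
      cvgn (series (fun jD : nat => limn (series (a jD)))),
      cvgn (series c)
    & 'E_P[fun w : T => Num.max (ln (1 + gD w) - ln (1 + gE w))%R 0%R]%E =
      (mD `^ mD * mE `^ mE / (Gamma mD * Gamma mE) *
         limn (series (fun jD : nat => limn (series (a jD))))
       - mE `^ mE / Gamma mE * limn (series c))%:E].
Proof.
move=> a c.
have row_cvg : forall jD, cvgn (series (a jD)) by exact: asc_term_row_cvg.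
have tot_cvg : cvgn (series (fun jD =>
  limn (series (a jD)))) by exact: asc_term_cvg.
have corr_cvg : cvgn (series c) by exact: asc_corr_term_cvg.
split=> //.
have mixD := ftr_gamma_mixture hmD hKD hDeltaD hsD hgD.
have mixE := ftr_gamma_mixture hmE hKE hDeltaE hsE hgE.
have Emax : ('E_P[fun w => Num.max (ln (1 + gD w)) (ln (1 + gE w))] =
    (mD `^ mD * mE `^ mE / (Gamma mD * Gamma mE) *
         limn (series (fun jD : nat => limn (series (a jD)))))%:E)%E.
  rewrite (expectation_max_ln1D_mixture hgD0 hgE0 hindep mixD mixE).
  transitivity (\sum_(i <oo) (mD `^ mD * mE `^ mE / (Gamma mD * Gamma mE) *
      limn (series (a i)))%:E)%E.
    apply: eq_eseriesr => i _; apply: cvg_series_EFin.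
    rewrite (_ : (fun _ => _) = fun j =>
      mD `^ mD * mE `^ mE / (Gamma mD * Gamma mE) * a i j);
        first exact: cvg_seriesZ.
    by apply/funext => j; rewrite /a asc_termE// (invfM (Gamma mD)); ring.
  by apply: cvg_series_EFin; exact: cvg_seriesZ.
have EE : ('E_P[fun w => ln (1 + gE w)] =
    (mE `^ mE / Gamma mE * limn (series c))%:E)%E.
  rewrite (expectation_ln1D_mixture hgE0 mixE); apply: cvg_series_EFin.
  rewrite (_ : (fun _ => _) = fun j => mE `^ mE / Gamma mE * c j);
    first exact: cvg_seriesZ.
  by apply/funext => j; rewrite /c asc_corr_termE; ring.
have mln (Z : {RV P >-> R}) : measurable_fun setT (fun w => ln (1 + Z w)).
  apply: measurableT_comp; first exact: measurable_ln.
  by apply: measurable_funD.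
(* Stated as a sum, so that all three expectations are of nonnegative functions. *)
have split_max : ('E_P[fun w => Num.max (ln (1 + gD w) - ln (1 + gE w))%R 0%R] +
    'E_P[fun w => ln (1 + gE w)] =
    'E_P[fun w => Num.max (ln (1 + gD w)) (ln (1 + gE w))])%E.
  rewrite unlock -ge0_integralD//.
  - by apply: eq_integral => w _; rewrite -EFinD addr_maxl subrK add0r.
  - by move=> w _; rewrite lee_fin le_max lexx orbT.
  - apply/measurable_EFinP; apply: measurable_maxr => //.
    exact: measurable_funB.
  - by move=> w _; rewrite lee_fin ln_ge0// lerDl.
  - exact/measurable_EFinP.
(* The cancelled expectation is finite, being the real number of [EE]. *)
by rewrite EFinB -Emax -EE -split_max addeK// EE.
Qed.
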